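(* Let $r$ be a positive integer and let $\nu$ be a complex Borel measure on $\mathbb{C}$ such that for some $\gamma>0$ the nonnegative measure $e^{\gamma|z|^{r}}|\nu|$ is finite, i.e. $\int_{\mathbb{C}} e^{\gamma|z|^{r}}\,d|\nu|(z)<\infty$. Suppose that the Toeplitz operator $T_\nu$ in the Bargmann space $B(\mathbb{C})$ with symbol $\nu$ has rank less than $r$. Then $\nu$ is a sum of less than $r$ point masses, i.e. there are an integer $0\le m<r$, points $\zeta_1,\dots,\zeta_m\in\mathbb{C}$ and coefficients $c_1,\dots,c_m\in\mathbb{C}$ with $\nu=\sum_{j=1}^m c_j\delta_{\zeta_j}$.
   Context: $B(\mathbb{C})$ is the Segal-Bargmann (Fock) space: the closed subspace of entire functions in $L^2(\mathbb{C},d\mu)$, where $d\mu(z)=\pi^{-1}e^{-|z|^2}dV(z)$ and $dV$ is Lebesgue measure on $\mathbb{C}\cong\mathbb{R}^2$. For a complex locally finite Borel measure $\nu$, $|\nu|$ denotes the nonnegative measure $|\nu|(E)=\mathrm{var}_E(\mathrm{Re}\,\nu)+\mathrm{var}_E(\mathrm{Im}\,\nu)$, where $\mathrm{var}_E$ is the variation of the measure over the Borel set $E$. The Toeplitz operator $T_\nu$ with the measure $\nu$ as symbol is considered on the dense set of analytic polynomials, through its sesquilinear form $$(T_\nu u,v)=\int_{\mathbb{C}}u(z)\overline{v(z)}\,d\nu(z),$$ where $u,v$ are analytic polynomials (polynomials in $z$). The rank of $T_\nu$ is the rank of this form, i.e. the dimension of the space of antilinear functionals $v\mapsto\int u\overline{v}\,d\nu$,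 $u$ ranging over all analytic polynomials (equivalently, the rank of the infinite matrix $\left(\int z^j\overline{z}^k\,d\nu(z)\right)_{j,k\ge0}$). *)

(* Defs.v *)
From HB Require Import structures.
From mathcomp Require Import all_boot all_order all_algebra.
From mathcomp Require Import complex.
From mathcomp Require Import all_classical all_reals all_analysis.

Set Implicit Arguments.
Unset Strict Implicit.
Unset Printing Implicit Defensive.
Import Order.TTheory GRing.Theory Num.Theory.
Import numFieldNormedType.Exports.
Local Open Scope classical_set_scope.
Local Open Scope complex_scope.
Local Open Scope ring_scope.

(* The complex plane with its Borel sigma-algebra; the alias R[i]^o is the one
   that carries the topology of the modulus. *)
Definition borelC (R : realType) := g_sigma_algebraType (@open (R[i])^o).

Section signed_measures.
Context d (T : measurableType d) (R : realType) (nu : {charge set T -> \bar R}).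

Lemma hahn_ex : exists PN : set T * set T, hahn_decomposition nu PN.1 PN.2.
Proof. by have [P [N PN]] := Hahn_decomposition nu; exists (P, N). Qed.

(* The Jordan parts below do not depend on the chosen Hahn decomposition; see
   Hahn_decomposition_uniq. *)
Definition hahn_choice :
    hahn_decomposition nu (sval (cid hahn_ex)).1 (sval (cid hahn_ex)).2 :=
  svalP (cid hahn_ex).

Definition charge_pos : {measure set T -> \bar R} := jordan_pos hahn_choice.
Definition charge_neg : {measure set T -> \bar R} := jordan_neg hahn_choice.
Definition signed_variation : {measure set T -> \bar R} :=
  charge_variation hahn_choice.

Definition charge_integral (f : T -> R) : R :=
  \int[charge_pos]_x f x - \int[charge_neg]_x f x.

End signed_measures.

(* A complex Borel measure, given by its real and imaginary parts, which are
   finite signed measures (charges take finite values on measurable sets). *)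
Record complex_measure (R : realType) := ComplexMeasure {
  cm_Re : {charge set (borelC R) -> \bar R};
  cm_Im : {charge set (borelC R) -> \bar R} }.

Definition cm_fun (R : realType) (nu : complex_measure R)
    (E : set (borelC R)) : R[i] :=
  fine (cm_Re nu E) +i* fine (cm_Im nu E).
Coercion cm_fun : complex_measure >-> Funclass.

(* |nu|(E) = var_E(Re nu) + var_E(Im nu); this is not the usual total variation
   of a complex measure, but is equivalent to it. *)
Definition cm_variation (R : realType) (nu : complex_measure R) :
    {measure set (borelC R) -> \bar R} :=
  measure_add (signed_variation (cm_Re nu)) (signed_variation (cm_Im nu)).

Definition cm_integral (R : realType) (nu : complex_measure R)
    (f : borelC R -> R[i]) : R[i] :=
  let reI g := charge_integral (cm_Re nu) g in
  let imI g := charge_integral (cm_Im nu) g in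
  (reI (fun z => complex.Re (f z)) - imI (fun z => complex.Im (f z))) +i*
  (imI (fun z => complex.Re (f z)) + reI (fun z => complex.Im (f z))).

(* The functional v |-> (T_nu u, v). *)
Definition toeplitz (R : realType) (nu : complex_measure R)
    (u : {poly R[i]}) : {poly R[i]} -> (R[i])^o :=
  fun v => cm_integral nu (fun z : borelC R => u.[z] * (v.[z])^*).

(* W, a subset of V closed under linear combinations, has dimension n. *)
Definition has_dimension (K : fieldType) (V : lmodType K) (W : set V)
    (n : nat) : Prop :=
  exists e : 'I_n -> V,
    [/\ forall i, W (e i),
        forall a : 'I_n -> K, \sum_i a i *: e i = 0 -> forall i, a i = 0 &
        forall w, W w -> exists a : 'I_n -> K, w = \sum_i a i *: e i].

Definition toeplitz_rank (R : realType) (nu : complex_measure R) (n : nat) :=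
  has_dimension (range (toeplitz nu)) n.

(* Main.v *)
Require Import Defs.
From HB Require Import structures.
From mathcomp Require Import all_boot all_order all_algebra.
From mathcomp Require Import fingroup perm complex.
From mathcomp Require Import all_classical all_reals all_analysis.
From mathcomp Require Import measurable_realfun zify ring lra.
Import Order.TTheory GRing.Theory Num.Theory.
Import numFieldNormedType.Exports.
Set Implicit Arguments.
Unset Strict Implicit.
Unset Printing Implicit Defensive.
Local Open Scope classical_set_scope.
Local Open Scope complex_scope.
Local Open Scope ring_scope.
Local Notation Re := complex.Re.
Local Notation Im := complex.Im.
Local Notation normc := ComplexField.Normc.normc.

(** The proof follows Luecking's determinant trick.  Put [N = n + 1 <= r].  Rank
    at most [n] means that the determinants of the [N x N] matrices with
    entries [\int u_j v_k^* dnu] vanish for all polynomials [u_j], [v_k].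

    By Leibniz's formula such a determinant is an integral over the [N]-fold
    power of the plane, and antisymmetrizing it over the monomials [z ^ j]
    gives the integral of [|V|^2], [V] being the Vandermonde determinant,
    against [nu x ... x nu].  The decay [exp (gamma |z| ^ r)] allows [nu] to be
    replaced by [cis (Im Q) nu], where [cis t = exp (i t)], for every polynomial
    [Q] of degree at most [r].  Indeed, for small [Q] the factor [cis (Im Q)] is
    a dominated limit of products of a polynomial and a conjugate polynomial
    ([cvg_phase_factor], [rank_lt_twist_small]), and since it has modulus one
    the decay is not affected, so the step can be iterated ([rank_lt_twist]).
    Hence [|V|^2 nu x ... x nu] is orthogonal to every
    [cis (\sum_j Im Q (z_j))], that is, to the characters of the power sums
    [\sum_j z_j ^ k] with [k <= N].

    Vanishing trigonometric integrals force the measure to vanish on every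
    event generated by these power sums ([trigonometric_uniqueness]).  By
    Newton's identities the power sums generate the symmetric functions
    [\prod_j (x - z_j)], hence the events [some z_j lies in O] for open [O]
    ([measurable_some_root]).  For disjoint open [O_i] the event that all the
    [O_i] are met is the union over the permutations of the products of the
    [O_i], which gives [\int_(O_1 x ... x O_N) |V|^2 dnu ... dnu = 0]
    ([vandermonde_mass_open]); a Dynkin argument replaces the [O_i] by Borel
    subsets ([vandermonde_mass_borel]).

    If the support of [nu] had [N] distinct points [zeta_i], one could choose
    Borel sets [A_i] shrinking to them on which [nu (A_i)] is comparable to the
    mass of a disc, and dividing by [\prod_i nu (A_i)] would give
    [|V (zeta)|^2 = 0], which is absurd ([few_support_points]).  So the support
    has at most [n] points and [nu] is the sum of its atoms. *)

(** * Complex numbers by components *)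

Section complex_components.
Context {R : realType}.
Implicit Types (x y z : R[i]) (u v : nat -> R[i]).

Lemma ReD x y : Re (x + y) = Re x + Re y.
Proof. by case: x; case: y. Qed.

Lemma ImD x y : Im (x + y) = Im x + Im y.
Proof. by case: x; case: y. Qed.

Lemma ReN x : Re (- x) = - Re x. Proof. by case: x. Qed.
Lemma ImN x : Im (- x) = - Im x. Proof. by case: x. Qed.

Lemma ReM x y : Re (x * y) = Re x * Re y - Im x * Im y.
Proof. by case: x; case: y. Qed.

Lemma ImM x y : Im (x * y) = Re x * Im y + Im x * Re y.
Proof. by case: x => a b; case: y. Qed.

Lemma Re_conj x : Re x^* = Re x. Proof. by case: x. Qed.
Lemma Im_conj x : Im x^* = - Im x. Proof. by case: x. Qed.

Lemma complex_eq x y : Re x = Re y -> Im x = Im y -> x = y.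
Proof. by case: x => a b; case: y => c d /= -> ->. Qed.

Lemma Re_sum I (s : seq I) (P : pred I) (F : I -> R[i]) :
  Re (\sum_(i <- s | P i) F i) = \sum_(i <- s | P i) Re (F i).
Proof. by apply: (big_morph (@complex.Re R)) => // x y; rewrite ReD. Qed.

Lemma Im_sum I (s : seq I) (P : pred I) (F : I -> R[i]) :
  Im (\sum_(i <- s | P i) F i) = \sum_(i <- s | P i) Im (F i).
Proof. by apply: (big_morph (@complex.Im R)) => // x y; rewrite ImD. Qed.

Lemma normc_sqr z : normc z ^+ 2 = Re z ^+ 2 + Im z ^+ 2.
Proof. by case: z => a b /=; rewrite sqr_sqrtr// addr_ge0// sqr_ge0. Qed.

Lemma normc_ge0 z : 0 <= normc z.
Proof. by case: z => a b; rewrite sqrtr_ge0. Qed.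

Lemma normc_Re z : `|Re z| <= normc z.
Proof.
rewrite -(ler_pXn2r (n := 2))// ?nnegrE ?normc_ge0//.
by rewrite normc_sqr real_normK ?num_real// lerDl sqr_ge0.
Qed.

Lemma normc_Im z : `|Im z| <= normc z.
Proof.
rewrite -(ler_pXn2r (n := 2))// ?nnegrE ?normc_ge0//.
by rewrite normc_sqr real_normK ?num_real// lerDr sqr_ge0.
Qed.

Lemma normc_le z : normc z <= `|Re z| + `|Im z|.
Proof.
rewrite -(ler_pXn2r (n := 2))// ?nnegrE ?normc_ge0 ?addr_ge0//.
rewrite normc_sqr sqrrD !real_normK ?num_real// lerD2r lerDl.
by rewrite mulrn_wge0// mulr_ge0.
Qed.

Lemma normc_conj z : normc z^* = normc z.
Proof. by case: z => a b /=; rewrite sqrrN. Qed.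

Lemma normc_real (a : R) : normc a%:C = `|a|.
Proof. by rewrite /= expr0n /= addr0 sqrtr_sqr. Qed.

Lemma normcX z n : normc (z ^+ n) = normc z ^+ n.
Proof.
elim: n => [|n IH]; first by rewrite !expr0 ComplexField.Normc.normc1.
by rewrite !exprS ComplexField.Normc.normcM IH.
Qed.

Lemma normc_sum I (s : seq I) (P : pred I) (F : I -> R[i]) :
  normc (\sum_(i <- s | P i) F i) <= \sum_(i <- s | P i) normc (F i).
Proof.
elim/big_rec2: _ => [|i y x _ h]; first by rewrite ComplexField.Normc.normc0.
by rewrite (le_trans (le_normcD _ _))// lerD2l.
Qed.

Lemma normc_prod I (s : seq I) (P : pred I) (F : I -> R[i]) :
  normc (\prod_(i <- s | P i) F i) = \prod_(i <- s | P i) normc (F i).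
Proof.
apply: (big_morph (@ComplexField.Normc.normc R)).
  exact: ComplexField.Normc.normcM.
exact: ComplexField.Normc.normc1.
Qed.

(** Convergence is taken componentwise, which keeps every limit of complex
    quantities inside real analysis. *)
Definition ccvg u z :=
  ((fun n => Re (u n)) @ \oo --> Re z) /\ ((fun n => Im (u n)) @ \oo --> Im z).

Lemma ccvg_cst z : ccvg (fun=> z) z.
Proof. by split; exact: cvg_cst. Qed.

Lemma ccvg_unique u z z' : ccvg u z -> ccvg u z' -> z = z'.
Proof.
move=> [a b] [a' b']; apply: complex_eq.
  exact: (cvg_unique _ a a').
exact: (cvg_unique _ b b').
Qed.

Lemma ccvgD u v x y : ccvg u x -> ccvg v y -> ccvg (fun n => u n + v n) (x + y).
Proof.
move=> [a b] [a' b']; split.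
  by under eq_fun do rewrite ReD; rewrite ReD; exact: cvgD.
by under eq_fun do rewrite ImD; rewrite ImD; exact: cvgD.
Qed.

Lemma ccvgM u v x y : ccvg u x -> ccvg v y -> ccvg (fun n => u n * v n) (x * y).
Proof.
move=> [a b] [a' b']; split.
  by under eq_fun do rewrite ReM; rewrite ReM; apply: cvgB; exact: cvgM.
by under eq_fun do rewrite ImM; rewrite ImM; apply: cvgD; exact: cvgM.
Qed.

Lemma ccvg_sum I (s : seq I) (P : pred I) (F : I -> nat -> R[i]) (l : I -> R[i]) :
  (forall i, ccvg (F i) (l i)) ->
  ccvg (fun n => \sum_(i <- s | P i) F i n) (\sum_(i <- s | P i) l i).
Proof.
move=> h; elim: s => [|i s IH].
  by under eq_fun do rewrite big_nil; rewrite big_nil; exact: ccvg_cst.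
under eq_fun do rewrite big_cons; rewrite big_cons; case: ifP => // _.
exact: ccvgD.
Qed.

Lemma ccvg_prod I (s : seq I) (P : pred I) (F : I -> nat -> R[i]) (l : I -> R[i]) :
  (forall i, ccvg (F i) (l i)) ->
  ccvg (fun n => \prod_(i <- s | P i) F i n) (\prod_(i <- s | P i) l i).
Proof.
move=> h; elim: s => [|i s IH].
  by under eq_fun do rewrite big_nil; rewrite big_nil; exact: ccvg_cst.
under eq_fun do rewrite big_cons; rewrite big_cons; case: ifP => // _.
exact: ccvgM.
Qed.

Lemma ccvg_normc u z :
  (fun n => normc (u n - z)) @ \oo --> (0 : R) -> ccvg u z.
Proof.
move=> h; split; apply/cvgrPdist_le => e e0;
  move/cvgrPdist_le : h => /(_ _ e0); apply: filterS => n;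
  rewrite sub0r normrN ger0_norm ?normc_ge0// distrC; apply: le_trans.
  by rewrite -ReN -ReD; exact: normc_Re.
by rewrite -ImN -ImD; exact: normc_Im.
Qed.

End complex_components.

(** * Integration of complex functions *)

Section complex_integral.
Context d (T : measurableType d) (R : realType).
Implicit Types (f g : T -> R[i]).

Definition cmeasurable f :=
  measurable_fun setT (fun x => Re (f x)) /\ measurable_fun setT (fun x => Im (f x)).

Lemma cmeasurable_cst z : cmeasurable (fun=> z).
Proof. by split; exact: measurable_cst. Qed.

Lemma cmeasurableD f g :
  cmeasurable f -> cmeasurable g -> cmeasurable (fun x => f x + g x).
Proof.
move=> [a b] [a' b']; split.
  by under eq_fun do rewrite /= ReD; exact: measurable_funD.
by under eq_fun do rewrite /= ImD; exact: measurable_funD.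
Qed.

Lemma cmeasurableM f g :
  cmeasurable f -> cmeasurable g -> cmeasurable (fun x => f x * g x).
Proof.
move=> [a b] [a' b']; split.
  under eq_fun do rewrite /= ReM.
  by apply: measurable_funB; exact: measurable_funM.
under eq_fun do rewrite /= ImM.
by apply: measurable_funD; exact: measurable_funM.
Qed.

Lemma cmeasurable_conj f : cmeasurable f -> cmeasurable (fun x => (f x)^*).
Proof.
move=> [a b]; split.
  by under eq_fun do rewrite /= Re_conj.
under eq_fun do rewrite /= Im_conj.
exact: measurableT_comp.
Qed.

Lemma cmeasurable_sum I (s : seq I) (P : pred I) (F : I -> T -> R[i]) :
  (forall i, cmeasurable (F i)) ->
  cmeasurable (fun x => \sum_(i <- s | P i) F i x).
Proof.
move=> h; elim: s => [|i s IH].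
  by under eq_fun do rewrite big_nil; exact: cmeasurable_cst.
under eq_fun do rewrite big_cons; case: (P i) => //.
exact: cmeasurableD.
Qed.

Lemma cmeasurableX f n : cmeasurable f -> cmeasurable (fun x => f x ^+ n).
Proof.
move=> mf; elim: n => [|n IH].
  by under eq_fun do rewrite expr0; exact: cmeasurable_cst.
by under eq_fun do rewrite exprS; exact: cmeasurableM.
Qed.

Lemma cmeasurable_horner (p : {poly R[i]}) f :
  cmeasurable f -> cmeasurable (fun x => p.[f x]).
Proof.
move=> mf; under eq_fun do rewrite horner_coef.
apply: cmeasurable_sum => i; apply: cmeasurableM; first exact: cmeasurable_cst.
exact: cmeasurableX.
Qed.

Lemma measurable_normc f :
  cmeasurable f -> measurable_fun setT (fun x => normc (f x)).
Proof.
move=> [a b].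
rewrite (_ : (fun x => _) = fun x => Num.sqrt (Re (f x) ^+ 2 + Im (f x) ^+ 2)).
  apply: (measurableT_comp (continuous_measurable_fun (@sqrt_continuous R))).
  apply: measurable_funD; exact: measurable_funX.
by apply/funext => x; rewrite -normc_sqr sqrtr_sqr ger0_norm// normc_ge0.
Qed.

Lemma cmeasurable_indic (A : set T) :
  measurable A -> cmeasurable (fun x => (\1_A x)%:C : R[i]).
Proof. by move=> mA; split; [exact: measurable_indic|exact: measurable_cst]. Qed.

Variable mu : {measure set T -> \bar R}.

Lemma integrable_EFinD (h k : T -> R) :
  mu.-integrable setT (EFin \o h) -> mu.-integrable setT (EFin \o k) ->
  mu.-integrable setT (EFin \o (fun x => h x + k x)).
Proof. by move=> ih ik; exact: integrableD ih ik. Qed.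

Lemma integrable_EFinZ (a : R) (h : T -> R) :
  mu.-integrable setT (EFin \o h) ->
  mu.-integrable setT (EFin \o (fun x => a * h x)).
Proof. by move=> ih; exact: integrableZl ih. Qed.

Definition cintegrable f :=
  mu.-integrable setT (EFin \o (fun x => Re (f x))) /\
  mu.-integrable setT (EFin \o (fun x => Im (f x))).

Definition cint f : R[i] :=
  (\int[mu]_x Re (f x)) +i* (\int[mu]_x Im (f x)).

Lemma cintegrable_cmeasurable f : cintegrable f -> cmeasurable f.
Proof.
move=> [/measurable_int a /measurable_int b].
by split; apply/measurable_EFinP.
Qed.

Lemma cintegrable_le f (g : T -> R) : cmeasurable f ->
  mu.-integrable setT (EFin \o g) -> (forall x, normc (f x) <= g x) ->
  cintegrable f.
Proof.
move=> [a b] ig fg; split; apply: le_integrable ig => //.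
- exact/measurable_EFinP.
- move=> x _ /=; rewrite lee_fin (le_trans (normc_Re _))//.
  by rewrite (le_trans (fg x))// ler_norm.
- exact/measurable_EFinP.
- move=> x _ /=; rewrite lee_fin (le_trans (normc_Im _))//.
  by rewrite (le_trans (fg x))// ler_norm.
Qed.

Lemma cintegrable_normc f : cintegrable f ->
  mu.-integrable setT (EFin \o (fun x => normc (f x))).
Proof.
move=> intf; have mf := cintegrable_cmeasurable intf.
have [a b] := intf.
apply: (@le_integrable _ _ _ _ _ _ _
  (fun x => (`|Re (f x)| + `|Im (f x)|)%:E)) => //.
- by apply/measurable_EFinP; exact: measurable_normc.
- move=> x _ /=; rewrite lee_fin ger0_norm ?normc_ge0// ger0_norm ?addr_ge0//.
  exact: normc_le.
- by apply: integrable_EFinD; [exact: integrable_norm a|exact: integrable_norm b].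
Qed.

Lemma cintegrableD f g :
  cintegrable f -> cintegrable g -> cintegrable (fun x => f x + g x).
Proof.
move=> [a b] [a' b']; split.
  under [X in EFin \o X]eq_fun do rewrite ReD; exact: integrable_EFinD.
under [X in EFin \o X]eq_fun do rewrite ImD; exact: integrable_EFinD.
Qed.

Lemma cintegrableZ z f : cintegrable f -> cintegrable (fun x => z * f x).
Proof.
move=> intf; have h := integrable_EFinZ (normc z) (cintegrable_normc intf).
apply: (@cintegrable_le _ (fun x => normc z * normc (f x))).
- apply: cmeasurableM; [exact: cmeasurable_cst|].
  exact: cintegrable_cmeasurable.
- exact: h.
- by move=> x; rewrite ComplexField.Normc.normcM.
Qed.

Lemma cintegrableM f g (M : R) : cintegrable f -> cmeasurable g ->
  (forall x, normc (g x) <= M) -> cintegrable (fun x => f x * g x).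
Proof.
move=> intf mg gM.
have h := integrable_EFinZ M (cintegrable_normc intf).
apply: (@cintegrable_le _ (fun x => M * normc (f x))).
- by apply: cmeasurableM => //; exact: cintegrable_cmeasurable.
- exact: h.
- by move=> x; rewrite ComplexField.Normc.normcM mulrC ler_wpM2r ?normc_ge0.
Qed.

Lemma cintegrable0 : cintegrable (fun=> 0).
Proof. by split; exact: integrable0. Qed.

Lemma cintegrable_sum I (s : seq I) (P : pred I) (F : I -> T -> R[i]) :
  (forall i, cintegrable (F i)) ->
  cintegrable (fun x => \sum_(i <- s | P i) F i x).
Proof.
move=> h; elim: s => [|i s IH].
  by under eq_fun do rewrite big_nil; exact: cintegrable0.
under eq_fun do rewrite big_cons; case: (P i) => //.
exact: cintegrableD.
Qed.

Lemma cintD f g : cintegrable f -> cintegrable g ->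
  cint (fun x => f x + g x) = cint f + cint g.
Proof.
move=> [a b] [a' b']; apply: complex_eq; rewrite ?ReD ?ImD /=.
  by under eq_Rintegral do rewrite ReD; rewrite RintegralD.
by under eq_Rintegral do rewrite ImD; rewrite RintegralD.
Qed.

Lemma cint0 : cint (fun=> 0) = 0.
Proof. by rewrite /cint /Rintegral !integral0. Qed.

Lemma cintZ z f : cintegrable f -> cint (fun x => z * f x) = z * cint f.
Proof.
move=> [a b]; apply: complex_eq; rewrite ?ReM ?ImM /=.
  under eq_Rintegral do rewrite ReM.
  by rewrite RintegralB//; [rewrite !RintegralZl//|exact: integrable_EFinZ..].
under eq_Rintegral do rewrite ImM.
by rewrite RintegralD//; [rewrite !RintegralZl//|exact: integrable_EFinZ..].
Qed.

Lemma cint_sum I (s : seq I) (P : pred I) (F : I -> T -> R[i]) :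
  (forall i, cintegrable (F i)) ->
  cint (fun x => \sum_(i <- s | P i) F i x) = \sum_(i <- s | P i) cint (F i).
Proof.
move=> h; elim: s => [|i s IH].
  by rewrite big_nil -[RHS]cint0; congr cint; apply/funext => x; rewrite big_nil.
rewrite big_cons; under [X in cint X]eq_fun do rewrite big_cons.
case: (P i) => //; rewrite cintD ?IH//.
exact: cintegrable_sum.
Qed.

Lemma normc_cint_le f (g : T -> R) : cmeasurable f ->
  mu.-integrable setT (EFin \o g) -> (forall x, normc (f x) <= g x) ->
  normc (cint f) <= 2 * \int[mu]_x g x.
Proof.
move=> mf ig fg; have [a b] := cintegrable_le mf ig fg.
rewrite (le_trans (normc_le _))// mulr_natl mulr2n; apply: lerD => /=.
  apply: le_trans (le_normr_Rintegral _ _) _ => //.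
  apply: le_Rintegral => //; first exact: integrable_norm a.
  by move=> x _; exact: le_trans (normc_Re _) (fg x).
apply: le_trans (le_normr_Rintegral _ _) _ => //.
apply: le_Rintegral => //; first exact: integrable_norm b.
by move=> x _; exact: le_trans (normc_Im _) (fg x).
Qed.

Lemma cvg_Rintegral (f_ : nat -> T -> R) (f g : T -> R) :
  (forall n, measurable_fun setT (f_ n)) ->
  (forall x, f_ ^~ x @ \oo --> f x) ->
  mu.-integrable setT (EFin \o g) ->
  (forall n x, `|f_ n x| <= g x) ->
  mu.-integrable setT (EFin \o f) /\
  (fun n => \int[mu]_x f_ n x) @ \oo --> \int[mu]_x f x.
Proof.
move=> mf_ f_f ig f_g.
have mf : measurable_fun setT f by exact: measurable_fun_cvg mf_ _.
have [] := @dominated_convergence _ T R mu setT measurableT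
  (fun n => EFin \o f_ n) (EFin \o f) (EFin \o g).
- by move=> n; exact/measurable_EFinP.
- exact/measurable_EFinP.
- by apply/nearW => x _ /=; apply: cvg_EFin; [exact: nearW|exact: f_f].
- exact: ig.
- by apply/nearW => x n _ /=; rewrite lee_fin.
move=> intf _ h; split=> //.
have fin : (\int[mu]_x (f x)%:E)%E \is a fin_num by exact: integrable_fin_num.
by apply: fine_cvg; rewrite fineK.
Qed.

Lemma ccvg_cint (f_ : nat -> T -> R[i]) f (g : T -> R) :
  (forall n, cmeasurable (f_ n)) ->
  (forall x, ccvg (f_ ^~ x) (f x)) ->
  mu.-integrable setT (EFin \o g) ->
  (forall n x, normc (f_ n x) <= g x) ->
  cintegrable f /\ ccvg (fun n => cint (f_ n)) (cint f).
Proof.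
move=> mf_ f_f ig f_g.
have [i1 c1] := @cvg_Rintegral (fun n => fun x => Re (f_ n x)) (fun x => Re (f x)) g
  (fun n => (mf_ n).1) (fun x => (f_f x).1) ig
  (fun n x => le_trans (normc_Re _) (f_g n x)).
have [i2 c2] := @cvg_Rintegral (fun n => fun x => Im (f_ n x)) (fun x => Im (f x)) g
  (fun n => (mf_ n).2) (fun x => (f_f x).2) ig
  (fun n x => le_trans (normc_Im _) (f_g n x)).
by [].
Qed.

End complex_integral.

(** * Powers of a measure space *)

Section product_integral.
Context d1 d2 (X : measurableType d1) (Y : measurableType d2) (R : realType).
Variables (m1 : {finite_measure set X -> \bar R}).
Variables (m2 : {finite_measure set Y -> \bar R}).

Lemma Rintegral_prod (f : X -> R) (g : Y -> R) :
  m1.-integrable setT (EFin \o f) -> m2.-integrable setT (EFin \o g) ->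
  (m1 \x m2)%E.-integrable setT (EFin \o (fun z => f z.1 * g z.2)) /\
  \int[(m1 \x m2)%E]_z (f z.1 * g z.2) = \int[m1]_x f x * \int[m2]_y g y.
Proof.
move=> intf intg.
have mf : measurable_fun setT f by case/integrableP: intf => /measurable_EFinP.
have mg : measurable_fun setT g by case/integrableP: intg => /measurable_EFinP.
have mfg : measurable_fun setT (fun z : X * Y => f z.1 * g z.2).
  by apply: measurable_funM;
    [exact: measurableT_comp mf _|exact: measurableT_comp mg _].
have intfg : (m1 \x m2)%E.-integrable setT (EFin \o (fun z => f z.1 * g z.2)).
  apply/integrable12ltyP; first exact/measurable_EFinP.
  have /integrableP[_ lf] := intf; have /integrableP[_ lg] := intg.
  have absE x : (\int[m2]_y `|(f x * g y)%:E| =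
      `|(f x)%:E| * \int[m2]_y `|(g y)%:E|)%E.
    under eq_integral do rewrite EFinM abseM.
    rewrite ge0_integralZl//; last exact/measurableT_comp/measurable_EFinP.
  rewrite /comp/=; under eq_integral do rewrite absE.
  rewrite ge0_integralZr//.
  - by rewrite lte_mul_pinfty ?integral_ge0// ge0_fin_numE ?integral_ge0.
  - exact/measurableT_comp/measurable_EFinP.
  - exact: integral_ge0.
split=> //; rewrite /Rintegral -fineM; [|exact: integrable_fin_num..].
congr fine; rewrite -integral12_prod_meas1//= /fubini_F/=.
under eq_integral do under eq_integral do rewrite EFinM.
under eq_integral do rewrite integralZl//.
have finG : (\int[m2]_y (g y)%:E)%E \is a fin_num by exact: integrable_fin_num.
by rewrite -(fineK finG) integralZr.
Qed.

Lemma cint_prod (f : X -> R[i]) (g : Y -> R[i]) :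
  cintegrable m1 f -> cintegrable m2 g ->
  cintegrable (m1 \x m2)%E (fun z => f z.1 * g z.2) /\
  cint (m1 \x m2)%E (fun z => f z.1 * g z.2) = cint m1 f * cint m2 g.
Proof.
move=> [f1 f2] [g1 g2].
have [i11 e11] := Rintegral_prod f1 g1; have [i12 e12] := Rintegral_prod f1 g2.
have [i21 e21] := Rintegral_prod f2 g1; have [i22 e22] := Rintegral_prod f2 g2.
split; first split.
- under [X in EFin \o X]eq_fun do rewrite ReM.
  exact: (@integrableB _ _ _ _ _ measurableT _ _ i11 i22).
- under [X in EFin \o X]eq_fun do rewrite ImM.
  exact: integrable_EFinD.
- apply: complex_eq; rewrite ?ReM ?ImM /= -?e11 -?e12 -?e21 -?e22.
    by under [X in Rintegral _ _ X = _]eq_fun do rewrite ReM; rewrite RintegralB.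
  by under [X in Rintegral _ _ X = _]eq_fun do rewrite ImM; rewrite RintegralD.
Qed.

Definition finite_product : set (X * Y) -> \bar R := (m1 \x m2)%E.

HB.instance Definition _ := Measure.on finite_product.

Let finite_product_fin : fin_num_fun finite_product.
Proof.
apply: lty_fin_num_fun.
suff : (finite_product setT < +oo)%E by [].
have -> : finite_product setT = (m1 setT * m2 setT)%E.
  by rewrite -product_measure1E// setXTT.
by rewrite lte_mul_pinfty// ?fin_num_measure// -ge0_fin_numE// fin_num_measure.
Qed.

HB.instance Definition _ := Measure_isFinite.Build _ _ _
  finite_product finite_product_fin.

End product_integral.

(** Only the integrals of products of one-variable functions are used, so the
    power is obtained by iterating the binary product and its concrete carrier
    is forgotten. *)
Lemma power_space d (X : measurableType d) (R : realType)
    (mu : {finite_measure set X -> \bar R}) (N : nat) :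
  exists (d' : measure_display) (T : measurableType d')
    (P : {finite_measure set T -> \bar R}) (pr : 'I_N -> T -> X),
    (forall i, measurable_fun setT (pr i)) /\
    forall f : 'I_N -> X -> R[i], (forall i, cintegrable mu (f i)) ->
      cintegrable P (fun t => \prod_i f i (pr i t)) /\
      cint P (fun t => \prod_i f i (pr i t)) = \prod_i cint mu (f i).
Proof.
elim: N => [|N [d' [T [P [pr [mpr IH]]]]]].
  exists _, unit, (dirac tt), 
    (fun (i : 'I_0) _ => False_rect X (notF (ltn_ord i))); split; first by case.
  move=> f _.
  under [X in cintegrable _ X]eq_fun do rewrite big_ord0.
  under [X in cint _ X]eq_fun do rewrite big_ord0.
  rewrite big_ord0; split.
    by split; apply: finite_measure_integrable_cst.
  apply: complex_eq => /=; rewrite Rintegral_cst//.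
    by rewrite mul1r -[RHS]/(fine 1%E); congr fine; exact: diracT.
  by rewrite mul0r.
exists _, [the measurableType _ of (X * T)%type], 
  (finite_product mu P),
  (fun i z => if unlift ord0 i is Some j then pr j z.2 else z.1); split.
  move=> i; case: unliftP => [j|] _; last exact: measurable_fst.
  exact: measurableT_comp (mpr j) measurable_snd.
move=> f intf.
have [i1 e1] := IH (fun j => f (lift ord0 j)) (fun j => intf _).
have [i2 e2] := cint_prod (intf ord0) i1.
have E : (fun z : X * T => \prod_(i < N.+1)
     f i (if unlift ord0 i is Some j then pr j z.2 else z.1)) =
   fun z => f ord0 z.1 * \prod_j f (lift ord0 j) (pr j z.2).
  apply/funext => z; rewrite big_ord_recl unlift_none; congr (_ * _).
  by apply: eq_bigr => j _; rewrite liftK.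
by rewrite E; split => //; rewrite e2 e1 big_ord_recl.
Qed.

(** * Uniqueness for trigonometric integrals *)

Section threshold.
Context {R : realType}.
Implicit Types x c : R.

Lemma bernoulli_le (u : R) (K : nat) : 0 <= u <= 1 -> 1 - K%:R * u <= (1 - u) ^+ K.
Proof.
move=> /andP[u0 u1]; elim: K => [|K IH]; first by rewrite mul0r subr0 expr0.
rewrite exprS (le_trans _ (ler_wpM2l _ IH)) ?subr_ge0//.
have : 0 <= K%:R * u ^+ 2 by rewrite mulr_ge0 ?sqr_ge0.
rewrite -natr1; nra.
Qed.

Lemma bernoulli_ge (u : R) (K : nat) : 0 <= u -> 1 + K%:R * u <= (1 + u) ^+ K.
Proof.
move=> u0; elim: K => [|K IH]; first by rewrite mul0r addr0 expr0.
rewrite exprS (le_trans _ (ler_wpM2l _ IH)) ?addr_ge0//.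
have : 0 <= K%:R * u ^+ 2 by rewrite mulr_ge0 ?sqr_ge0.
rewrite -natr1; nra.
Qed.

Lemma bernoulli_inv (u : R) (K : nat) : 0 <= u <= 1 ->
  (1 - u) ^+ K * (1 + K%:R * u) <= 1.
Proof.
move=> /andP[u0 u1].
apply: le_trans (_ : (1 - u) ^+ K * (1 + u) ^+ K <= 1).
  by rewrite ler_wpM2l ?exprn_ge0 ?subr_ge0// bernoulli_ge.
by rewrite -exprMn exprn_ile1//; nra.
Qed.

Lemma cvg_natmul_expr c : 0 <= c < 1 -> (fun n => n%:R * c ^+ n) @ \oo --> (0 : R).
Proof.
move=> /andP[c0 c1]; have [->|cn0] := eqVneq c 0.
  rewrite (_ : (fun n => _) = fun=> 0); first exact: cvg_cst.
  by apply/funext => -[|n]; rewrite ?mul0r// expr0n mulr0.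
pose s := Num.sqrt c.
have s0 : 0 < s by rewrite sqrtr_gt0 lt_def cn0.
have s1 : s < 1.
  by rewrite -(ltr_pXn2r (n := 2)) ?nnegrE ?ltW// sqr_sqrtr// expr1n.
have sc : c = s ^+ 2 by rewrite sqr_sqrtr.
pose x := s^-1 - 1.
have x0 : 0 < x by rewrite subr_gt0 invf_gt1.
have sx : s * (1 + x) = 1 by rewrite /x addrC subrK divff ?gt_eqF.
(* [c ^ n] is [s ^ n * s ^ n], and [n * s ^ n] stays bounded by Bernoulli. *)
have bnd n : n%:R * s ^+ n <= x^-1.
  rewrite -div1r ler_pdivlMr// mulrAC.
  have h := bernoulli_ge n (ltW x0).
  have p0 : 0 <= s ^+ n by rewrite exprn_ge0 // ltW.
  have := ler_wpM2l p0 h; rewrite -exprMn sx expr1n; nra.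
have lim : (fun n => x^-1 * s ^+ n) @ \oo --> (0 : R).
  rewrite -[X in _ --> X](mulr0 (x^-1)); apply: cvgM; first exact: cvg_cst.
  by apply: cvg_expr; rewrite gtr0_norm.
apply: squeeze_cvgr lim; last exact: cvg_cst.
apply: nearW => n; rewrite sc exprAC expr2 mulrA.
have p0 : 0 <= s ^+ n by rewrite exprn_ge0 // ltW.
by rewrite !mulr_ge0//= ler_wpM2r// bnd.
Qed.

(** The exponent [n 2^n] makes the polynomials in [x] converge at every point
    of the unit interval, the threshold included. *)
Definition threshold_poly (n : nat) x := (1 - x ^+ n) ^+ (n * 2 ^ n).

Lemma threshold_poly_ge0_le1 n x : 0 <= x <= 1 -> 0 <= threshold_poly n x <= 1.
Proof.
move=> /andP[x0 x1]; have xn0 : 0 <= x ^+ n by rewrite exprn_ge0.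
have xn1 : x ^+ n <= 1 by rewrite exprn_ile1.
by rewrite exprn_ge0 ?exprn_ile1 ?subr_ge0// lerBlDr lerDl.
Qed.

Lemma cvg_threshold_poly x : 0 <= x <= 1 ->
  (fun n => threshold_poly n x) @ \oo --> ((x < 2^-1)%R%:R : R).
Proof.
move=> x01; have /andP[x0 x1] := x01.
have xn01 n : 0 <= x ^+ n <= 1 by rewrite exprn_ge0// exprn_ile1.
have [xlt|xge] := ltP x 2^-1.
  have c01 : 0 <= 2 * x < 1.
    by rewrite mulr_ge0//= mulrC -ltr_pdivlMr// div1r.
  have lim : (fun n => 1 - n%:R * (2 * x) ^+ n) @ \oo --> (1 : R).
    rewrite -[X in _ --> X]subr0; apply: cvgB; first exact: cvg_cst.
    exact: cvg_natmul_expr.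
  apply: squeeze_cvgr lim (cvg_cst _); apply: nearW => n.
  have /andP[_ ->] := threshold_poly_ge0_le1 n x01; rewrite andbT.
  apply: le_trans (bernoulli_le _ (xn01 n)).
  by rewrite natrM natrX exprMn mulrA.
have lim : (fun n => 1 / (1 + n%:R)) @ \oo --> (0 : R).
  rewrite (_ : (fun n => _) = harmonic); first exact: cvg_harmonic.
  by apply/funext => n; rewrite div1r addrC natr1.
apply: squeeze_cvgr (cvg_cst _) lim; apply: nearW => n.
have /andP[-> _] /= := threshold_poly_ge0_le1 n x01.
rewrite ler_pdivlMr ?ltr_wpDr//.
have h := bernoulli_inv (n * 2 ^ n) (xn01 n).
have /andP[_ xn1] := xn01 n.
apply: le_trans h; rewrite ler_wpM2l ?exprn_ge0 ?subr_ge0//.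
rewrite lerD2l natrM natrX -mulrA -exprMn ler_peMr//.
by rewrite exprn_ege1// mulrC -ler_pdivrMr// div1r.
Qed.

End threshold.

Lemma cvg_difference_quotient (R : realType) (f : R -> R) (c x : R) :
  is_derive (0 : R) 1 f c ->
  (fun n => n.+1%:R * (f (x / n.+1%:R) - f 0)) @ \oo --> x * c.
Proof.
move=> [df dc]; have [->|x0] := eqVneq x 0.
  under eq_fun do rewrite mul0r subrr mulr0.
  by rewrite mul0r; exact: cvg_cst.
have lim : (fun h : R => h^-1 *: (f (h *: 1 + 0) - f 0)) h @[h --> 0^'] --> c.
  by rewrite -dc; exact: df.
have un : (fun n => x / n.+1%:R) @ \oo --> (0 : R).
  by rewrite -[X in _ --> X](mulr0 x); apply: cvgM; [exact: cvg_cst|exact: cvg_harmonic].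
have un0 n : x / n.+1%:R != 0 by rewrite mulf_neq0// invr_neq0.
have /= h := (cvgr_dnbhsP _ _ _).1 lim _ (conj un0 un).
rewrite (_ : (fun n => _) = fun n =>
   x * ((x / n.+1%:R)^-1 *: (f ((x / n.+1%:R) *: 1 + 0) - f 0))).
  by apply: cvgM; [exact: cvg_cst|exact: h].
apply/funext => n; rewrite /GRing.scale/= mulr1 addr0 mulrA; congr (_ * _).
by rewrite invf_div mulrCA divff// mulr1.
Qed.

Section trigonometric_uniqueness.
Context d (T : measurableType d) (R : realType).
Variables (P : {measure set T -> \bar R}) (g : T -> R) (Th : set (T -> R)).
Hypothesis intg : P.-integrable setT (EFin \o g).
Hypothesis mTh : forall th, Th th -> measurable_fun setT th.
Hypothesis ThD : forall th th', Th th -> Th th' -> Th (fun t => th t + th' t).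
Hypothesis ThZ : forall a th, Th th -> Th (fun t => a * th t).
Hypothesis g_cos : forall th, Th th -> \int[P]_t (g t * cos (th t)) = 0.
Hypothesis g_sin : forall th, Th th -> \int[P]_t (g t * sin (th t)) = 0.
Hypothesis Th0 : Th (fun=> 0).
Implicit Types f m th : T -> R.

Definition bounded_measurable f :=
  measurable_fun setT f /\ exists M, forall t, `|f t| <= M.

Let I f := \int[P]_t (g t * f t).

Let integrable_mul f :
  bounded_measurable f -> P.-integrable setT (EFin \o (fun t => g t * f t)).
Proof.
move=> [mf [M fM]].
have mg : measurable_fun setT g by case/integrableP: intg => /measurable_EFinP.
have iMg := integrable_EFinZ M (integrable_norm intg).
apply: le_integrable iMg => //; first exact/measurable_EFinP/measurable_funM.
move=> t _ /=; rewrite lee_fin normrM mulrC (le_trans _ (ler_norm _))//.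
by rewrite ler_wpM2r.
Qed.

Let I_lin a b f f' : bounded_measurable f -> bounded_measurable f' ->
  I (fun t => a * f t + b * f' t) = a * I f + b * I f'.
Proof.
move=> /integrable_mul i1 /integrable_mul i2; rewrite /I.
under eq_Rintegral do rewrite mulrDr !(mulrCA (g _)).
by rewrite RintegralD ?RintegralZl//; exact: integrable_EFinZ.
Qed.

Let bmM f f' : bounded_measurable f -> bounded_measurable f' ->
  bounded_measurable (fun t => f t * f' t).
Proof.
move=> [mf [M fM]] [mf' [M' fM']]; split; first exact: measurable_funM.
by exists (M * M') => t; rewrite normrM ler_pM.
Qed.

Let bm_lin a b f f' : bounded_measurable f -> bounded_measurable f' ->
  bounded_measurable (fun t => a * f t + b * f' t).
Proof.
move=> [mf [M fM]] [mf' [M' fM']]; split.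
  by apply: measurable_funD; apply: measurable_funM => //; exact: measurable_cst.
exists (`|a| * M + `|b| * M') => t; rewrite (le_trans (ler_normD _ _))//.
by rewrite !normrM lerD// ler_wpM2l.
Qed.

Let bm_cst a : bounded_measurable (fun=> a).
Proof. by split; [exact: measurable_cst|exists `|a|]. Qed.

Let bm_cos th : Th th -> bounded_measurable (fun t => cos (th t)).
Proof.
move=> /mTh mth; split; last by exists 1 => t; exact: cos_max.
exact: (measurableT_comp (continuous_measurable_fun (@continuous_cos R)) mth).
Qed.

Let bm_sin th : Th th -> bounded_measurable (fun t => sin (th t)).
Proof.
move=> /mTh mth; split; last by exists 1 => t; exact: sin_max.
exact: (measurableT_comp (continuous_measurable_fun (@continuous_sin R)) mth).
Qed.

Let I_lim (f_ : nat -> T -> R) f M :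
  (forall n, measurable_fun setT (f_ n)) -> (forall n t, `|f_ n t| <= M) ->
  (forall t, f_ ^~ t @ \oo --> f t) -> (fun n => I (f_ n)) @ \oo --> I f.
Proof.
move=> mf_ f_M f_f.
have mg : measurable_fun setT g by case/integrableP: intg => /measurable_EFinP.
apply: (@cvg_Rintegral _ _ _ P (fun n t => g t * f_ n t) _
  (fun t => M * `|g t|) _ _ _ _).2.
- by move=> n; exact: measurable_funM.
- by move=> t; apply: cvgM; [exact: cvg_cst|exact: f_f].
- exact: integrable_EFinZ (integrable_norm intg).
- by move=> n t; rewrite normrM mulrC ler_wpM2r.
Qed.

Definition trig_null f := bounded_measurable f /\
  forall th, Th th ->
    I (fun t => f t * cos (th t)) = 0 /\ I (fun t => f t * sin (th t)) = 0.

(** Multipliers form an algebra that is closed under bounded pointwise limits;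
    this is what turns sines into indicators. *)
Definition multiplier m := bounded_measurable m /\
  forall f, trig_null f -> trig_null (fun t => f t * m t).

Let trig_null1 : trig_null (fun=> 1).
Proof.
split=> // th Hth; rewrite /I.
under eq_Rintegral do rewrite mul1r.
by under [X in _ /\ X = _]eq_Rintegral do rewrite mul1r; rewrite g_cos// g_sin.
Qed.

Let trig_null_lin a b f f' :
  trig_null f -> trig_null f' -> trig_null (fun t => a * f t + b * f' t).
Proof.
move=> [bf nf] [bf' nf']; split; first exact: bm_lin.
move=> th Hth; have [c s] := nf _ Hth; have [c' s'] := nf' _ Hth; split.
  rewrite (_ : (fun t => _) = fun t => a * (f t * cos (th t)) +
    b * (f' t * cos (th t))); last by apply/funext => t; ring.
  by rewrite I_lin ?c ?c' ?mulr0 ?addr0//; apply: bmM => //; exact: bm_cos.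
rewrite (_ : (fun t => _) = fun t => a * (f t * sin (th t)) +
  b * (f' t * sin (th t))); last by apply/funext => t; ring.
by rewrite I_lin ?s ?s' ?mulr0 ?addr0//; apply: bmM => //; exact: bm_sin.
Qed.

(** Products of sines and cosines are sums of such, so the orthogonality
    relations survive multiplication by a sine. *)
Let multiplier_sin th : Th th -> multiplier (fun t => sin (th t)).
Proof.
move=> Hth; split; first exact: bm_sin.
move=> f [bf nf]; split; first by apply: bmM => //; exact: bm_sin.
move=> th' Hth'.
have HD : Th (fun t => th t + th' t) by exact: ThD.
have HB : Th (fun t => th t - th' t).
  by under eq_fun do rewrite -mulN1r; apply: ThD => //; exact: ThZ.
have [cD sD] := nf _ HD; have [cB sB] := nf _ HB; split.
  rewrite (_ : (fun t => _) = fun t => 2^-1 * (f t * sin (th t + th' t)) +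
      2^-1 * (f t * sin (th t - th' t))).
    by rewrite I_lin ?sD ?sB ?mulr0 ?addr0//; apply: bmM => //; exact: bm_sin.
  by apply/funext => t; rewrite sinD sinB; field.
rewrite (_ : (fun t => _) = fun t => 2^-1 * (f t * cos (th t - th' t)) +
    - 2^-1 * (f t * cos (th t + th' t))).
  by rewrite I_lin ?cD ?cB ?mulr0 ?addr0//; apply: bmM => //; exact: bm_cos.
by apply/funext => t; rewrite cosB cosD; field.
Qed.

Let multiplier_affine a b m :
  multiplier m -> multiplier (fun t => a + b * m t).
Proof.
move=> [bmm nm]; split.
  have := bm_lin a b (bm_cst 1) bmm.
  by under eq_fun do rewrite mulr1.
move=> f nf; have := trig_null_lin a b nf (nm _ nf).
rewrite (_ : (fun t => _) = fun t => f t * (a + b * m t))//.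
by apply/funext => t; ring.
Qed.

Let multiplier1 : multiplier (fun=> 1).
Proof. by split=> // f nf; under eq_fun do rewrite mulr1. Qed.

Let multiplierM m m' :
  multiplier m -> multiplier m' -> multiplier (fun t => m t * m' t).
Proof.
move=> [bm1 nm] [bm2 nm']; split; first exact: bmM.
by move=> f nf; under eq_fun do rewrite mulrA; exact/nm'/nm.
Qed.

Let multiplierX m n : multiplier m -> multiplier (fun t => m t ^+ n).
Proof.
move=> mm; elim: n => [|n IH]; first by under eq_fun do rewrite expr0.
by under eq_fun do rewrite exprS; exact: multiplierM.
Qed.

Let multiplier_lim (m_ : nat -> T -> R) m M :
  (forall n, multiplier (m_ n)) -> (forall n t, `|m_ n t| <= M) ->
  (forall t, `|m t| <= M) ->
  (forall t, m_ ^~ t @ \oo --> m t) -> multiplier m.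
Proof.
move=> mm m_M mM m_m.
have mm_ n : measurable_fun setT (m_ n) by have [[]] := mm n.
have bmm : bounded_measurable m.
  by split; [exact: measurable_fun_cvg mm_ _|exists M].
split=> // f nf; have [bf [A fA]] := nf.1; split; first exact: bmM nf.1 bmm.
have lim (k : T -> R) : measurable_fun setT k -> (forall t, `|k t| <= 1) ->
    (forall n, I (fun t => f t * m_ n t * k t) = 0) ->
    I (fun t => f t * m t * k t) = 0.
  move=> mk k1 I0.
  have h : (fun n => I (fun t => f t * m_ n t * k t)) @ \oo -->
      I (fun t => f t * m t * k t); last first.
    apply: (cvg_unique _ h) => //.
    rewrite (_ : (fun n => _) = fun=> 0); first exact: cvg_cst.
    exact/funext.
  apply: (@I_lim _ _ (A * M)).
  - by move=> n; apply: measurable_funM => //; exact: measurable_funM.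
  - move=> n t; rewrite !normrM -[leRHS]mulr1; apply: ler_pM => //.
    by rewrite ler_pM.
  - move=> t; apply: cvgM; last exact: cvg_cst.
    by apply: cvgM; [exact: cvg_cst|exact: m_m].
move=> th Hth; have [/= mc _] := bm_cos Hth; have [/= ms _] := bm_sin Hth.
split; apply: lim => // [t|n]; rewrite ?cos_max ?sin_max//.
  by have [_ /(_ _ Hth)[]] := (mm n).2 _ nf.
by have [_ /(_ _ Hth)[]] := (mm n).2 _ nf.
Qed.

Definition multiplier_sets : set (set T) :=
  [set B | measurable B /\ multiplier (\1_B : T -> R)].

(** A countable union is the limit of finite ones, whose complements have the
    product of the complementary indicators as indicator. *)
Lemma multiplier_sets_sigma_algebra : sigma_algebra setT multiplier_sets.
Proof.
split.
- split=> //; rewrite indic0.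
  have := multiplier_affine 0 0 multiplier1.
  by under eq_fun do rewrite mul0r addr0.
- move=> A [mA hA]; split; first exact: measurableD.
  have := multiplier_affine 1 (-1) hA.
  rewrite (_ : (fun t => _) = \1_(setT `\` A))//.
  by apply/funext => t; rewrite !indicE in_setD in_setT/=; case: (t \in A) => /=; ring.
- move=> A hA; split; first by apply: bigcupT_measurable => n; case: (hA n).
  pose m_ n t : R := \prod_(i < n) (1 + -1 * \1_(A i) t).
  have mm n : multiplier (m_ n).
    elim: n => [|n IH].
      by rewrite /m_; under eq_fun do rewrite big_ord0.
    rewrite /m_; under eq_fun do rewrite big_ord_recr.
    by apply: multiplierM => //; apply: multiplier_affine; case: (hA n).
  have m01 n t : 0 <= m_ n t <= 1.
    rewrite /m_; elim: n => [|n IH]; first by rewrite big_ord0 ler01 lexx.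
    rewrite big_ord_recr/= indicE; move: IH; case: (t \in A n) => /=.
      by rewrite mulN1r subrr mulr0 ler01 lexx.
    by rewrite mulr0 addr0 mulr1.
  suff h : multiplier (fun t => 1 + -1 * \1_(\bigcup_k A k) t).
    have := multiplier_affine 1 (-1) h.
    rewrite (_ : (fun t => _) = \1_(\bigcup_k A k))//.
    by apply/funext => t; ring.
  apply: (@multiplier_lim m_ _ 1) => //.
  - by move=> n t; have /andP[h0 h1] := m01 n t; rewrite ger0_norm.
  - move=> t; rewrite indicE; case: (t \in _) => /=.
      by rewrite mulr1 subrr normr0.
    by rewrite mulr0 addr0 normr1.
  - move=> t; rewrite indicE; case: (boolP (t \in _)) => [|/negP] /=.
      rewrite inE => -[k _ Akt]; rewrite mulN1r subrr.
      apply: cvg_near_cst; exists k.+1 => // n /= kn.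
      rewrite /m_ (bigD1 (Ordinal kn))//= indicE mem_set//= mulN1r subrr.
      by rewrite mul0r.
    move=> tA; rewrite mulr0 addr0.
    rewrite (_ : m_ ^~ t = fun=> 1); first exact: cvg_cst.
    apply/funext => n; rewrite /m_ big1// => i _; rewrite indicE memNset/=.
      by rewrite mulr0 addr0.
    by move=> At; apply: tA; rewrite inE; exists i.
Qed.

Lemma integral_multiplier_sets B : multiplier_sets B ->
  \int[P]_t (g t * \1_B t) = 0.
Proof.
move=> [mB [_ /(_ _ trig_null1)[_ /(_ _ Th0)[+ _]]]].
rewrite /I => <-; apply: eq_Rintegral => t _.
by rewrite mul1r cos0 mulr1.
Qed.

(** The polynomials [threshold_poly n] of a rescaled sine converge to the
    indicator of a set [a < sin th], so sines are measurable; and [th] is the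
    limit of [n * sin (th / n)]. *)
Lemma multiplier_sets_measurable_fun th : Th th ->
  measurable_fun (setT : set (g_sigma_algebraType multiplier_sets)) th.
Proof.
move=> Hth.
have sets_sin th' (a : R) : Th th' -> multiplier_sets [set t | a < sin (th' t)].
  move=> Hth'.
  have mset : measurable [set t | a < sin (th' t)].
    rewrite (_ : [set t | _] = (fun t => sin (th' t)) @^-1` `]a, +oo[%classic).
      by rewrite -[X in measurable X]setTI; have [+ _] := bm_sin Hth'; apply.
    by apply/seteqP; split => t /=; rewrite in_itv/= andbT.
  split=> //.
  (* [f] stays in the unit interval and is below [1/2] exactly when
     [a < sin (th' t)]. *)
  pose b := 2 + `|a|.
  have b0 : 0 < b by rewrite ltr_pwDl.
  pose f t := (1 + a / b) / 2 + - (2 * b)^-1 * sin (th' t).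
  have fE t : f t = 2^-1 - (sin (th' t) - a) / (2 * b).
    by rewrite /f; field; rewrite gt_eqF.
  have f01 t : 0 <= f t <= 1.
    have := sin_max (th' t); rewrite ler_norml => /andP[s1 s2].
    have a1 := ler_norm a; have := ler_norm (- a); rewrite normrN => a2.
    have h : `|(sin (th' t) - a) / (2 * b)| <= 2^-1.
      rewrite normrM normfV [`|2 * b|]gtr0_norm ?mulr_gt0//.
      rewrite ler_pdivrMr ?mulr_gt0// mulKf//.
      by rewrite ler_norml /b; apply/andP; split; lra.
    by move: h; rewrite fE ler_norml => /andP[h1 h2]; apply/andP; split; lra.
  have mf : multiplier f by apply: multiplier_affine; exact: multiplier_sin.
  apply: (@multiplier_lim (fun n t => threshold_poly n (f t)) _ 1).
  - move=> n; apply: multiplierX.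
    have := multiplier_affine 1 (-1) (multiplierX n mf).
    by under eq_fun do rewrite mulN1r.
  - move=> n t; have /andP[h0 h1] := threshold_poly_ge0_le1 n (f01 t).
    by rewrite ger0_norm.
  - by move=> t; rewrite indicE ger0_norm// lern1 leq_b1.
  - move=> t; have := cvg_threshold_poly (f01 t).
    rewrite fE gtrBl pmulr_lgt0 ?invr_gt0 ?mulr_gt0// subr_gt0.
    by rewrite indicE mem_setE.
pose U := g_sigma_algebraType multiplier_sets.
have msin th' : Th th' ->
    measurable_fun (setT : set U) (fun t => sin (th' t)).
  move=> Hth'; apply: (measurability _ (RGenOInfty.measurableE R)).
  move=> _ [_ [a ->] <-]; rewrite setTI; apply: sub_sigma_algebra.
  rewrite (_ : _ @^-1` _ = [set t | a < sin (th' t)]); first exact: sets_sin.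
  by apply/seteqP; split => t /=; rewrite in_itv/= andbT.
apply: (@measurable_fun_cvg _ U R setT
    (fun n t => n.+1%:R * sin (n.+1%:R^-1 * th t))).
  move=> n; apply: measurable_funM; first exact: measurable_cst.
  exact: (msin (fun t => _ * th t) (ThZ _ Hth)).
move=> t _; have dsin : is_derive (0 : R) 1 (@sin R) 1.
  by have := is_derive_sin (0 : R); rewrite cos0.
have := @cvg_difference_quotient R (@sin R) 1 (th t) dsin; rewrite mulr1.
rewrite (_ : (fun n => _) = fun n => n.+1%:R * sin (n.+1%:R^-1 * th t))//.
by apply/funext => n; rewrite sin0 subr0 [_^-1 * _]mulrC.
Qed.

End trigonometric_uniqueness.

(** The indicator of every set generated by the functions in [Th] is a
    multiplier, hence orthogonal to [g]. *)
Lemma trigonometric_uniqueness d (T : measurableType d) (R : realType)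
    (P : {measure set T -> \bar R}) (g : T -> R) (Th : set (T -> R)) :
  P.-integrable setT (EFin \o g) ->
  (forall th, Th th -> measurable_fun setT th) ->
  (forall th th', Th th -> Th th' -> Th (fun t => th t + th' t)) ->
  (forall a th, Th th -> Th (fun t => a * th t)) ->
  Th (fun=> 0) ->
  (forall th, Th th -> \int[P]_t (g t * cos (th t)) = 0) ->
  (forall th, Th th -> \int[P]_t (g t * sin (th t)) = 0) ->
  exists S : set (set T),
    (forall th, Th th ->
      measurable_fun (setT : set (g_sigma_algebraType S)) th) /\
    forall B : set (g_sigma_algebraType S), measurable B ->
      measurable (B : set T) /\ \int[P]_t (g t * \1_B t) = 0.
Proof.
move=> intg mTh ThD ThZ Th0 g_cos g_sin; exists (multiplier_sets P g Th); split.
  by move=> th Hth; exact: multiplier_sets_measurable_fun Hth.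
move=> B; rewrite /measurable/= (sigma_algebra_id (multiplier_sets_sigma_algebra
  intg mTh)) => hB.
split; first by case: hB.
exact: (@integral_multiplier_sets _ _ _ P g Th).
Qed.

(** * Power sums and the sets met by the roots *)

Section newton.
Context {F : idomainType}.

Lemma deriv_prod (I : eqType) (s : seq I) (f : I -> {poly F}) : uniq s ->
  (\prod_(i <- s) f i)^`() =
  \sum_(i <- s) (f i)^`() * \prod_(l <- s | l != i) f l.
Proof.
elim: s => [|a s IH] /=; first by rewrite !big_nil derivC.
move=> /andP[as_ us]; rewrite !big_cons derivM IH// eqxx /=; congr (_ * _ + _).
  rewrite big_seq_cond [RHS]big_seq_cond; apply: eq_bigl => l.
  by case: eqVneq => [->|_]; rewrite ?andbT// (negbTE as_).
rewrite mulr_sumr; apply: eq_big_seq => i is_; rewrite big_cons.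
have -> : a != i by apply: contraNneq as_ => ->.
by rewrite mulrCA.
Qed.

(** Newton's identities: comparing coefficients in
    [p' = \sum_j p / ('X - z j)], where the coefficients of the quotients come
    from synthetic division. *)
Lemma newton_identities (N : nat) (z : 'I_N -> F) (q k : nat) :
  (k + q = N)%N ->
  let p := \prod_j ('X - (z j)%:P) in
  q%:R * p`_k = - \sum_(i < q) (\sum_j z j ^+ i.+1) * p`_(k + i.+1).
Proof.
move=> kqN p.
pose Q j := \prod_(l | l != j) ('X - (z l)%:P).
have pQ j : p = ('X - (z j)%:P) * Q j by rewrite /p (bigD1 j).
have sizep : size p = N.+1.
  by rewrite /p -big_enum/= size_prod_XsubC -cardE card_ord.
have sizeQ j : (size (Q j) <= N)%N.
  have Qn0 : Q j != 0 by exact/monic_neq0/monic_prod_XsubC.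
  have := sizep; rewrite (pQ j) size_monicM ?monicXsubC// size_XsubC.
  by rewrite add2n => -[->].
have coefQ j m i : (i + m = N)%N ->
    (Q j)`_i = \sum_(l < m) z j ^+ l * p`_(i + l.+1).
  elim: m i => [|m IH] i imN.
    by rewrite big_ord0 nth_default// (leq_trans (sizeQ j))// -imN addn0.
  have := congr1 (fun u : {poly F} => u`_i.+1) (pQ j).
  rewrite /= mulrBl coefB coefXM coefCM/= => h.
  have -> : (Q j)`_i = p`_i.+1 + z j * (Q j)`_i.+1 by rewrite h subrK.
  rewrite (IH i.+1) ?addSnnS// big_ord_recl/= expr0 mul1r addn1 mulr_sumr.
  congr (_ + _); apply: eq_bigr => l _.
  by rewrite mulrA -exprS /bump/= add1n addSnnS.
case: k kqN => [|k] kqN.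
  rewrite add0n in kqN; subst q.
  have : \sum_j p.[z j] = 0.
    by apply: big1 => j _; rewrite (pQ j) hornerM hornerXsubC subrr mul0r.
  under eq_bigr do rewrite horner_coef sizep big_ord_recl expr0 mulr1.
  rewrite big_split/= sumr_const card_ord -[_ *+ N]mulr_natl => /addr0_eq h.
  rewrite -[LHS]opprK h; congr (- _); rewrite exchange_big/=; apply: eq_bigr => i _.
  by rewrite mulr_suml; apply: eq_bigr => j _; rewrite mulrC.
have dp : p^`() = \sum_j Q j.
  rewrite /p -big_enum/= deriv_prod ?enum_uniq// big_enum/=.
  by apply: eq_bigr => j _; rewrite derivXsubC mul1r big_enum_cond.
have hk : p`_k.+1 *+ k.+1 =
    \sum_(l < q.+1) (\sum_j z j ^+ l) * p`_(k + l.+1).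
  rewrite -coef_deriv dp coef_sum.
  under eq_bigr => j _ do rewrite (coefQ j q.+1 k) ?addnS//.
  rewrite exchange_big/=; apply: eq_bigr => l _.
  by rewrite mulr_suml.
move: hk; rewrite big_ord_recl/=.
under [X in X * _ + _]eq_bigr do rewrite expr0.
rewrite sumr_const card_ord addn1.
have -> : N%:R = k.+1%:R + q%:R :> F by rewrite -natrD kqN.
rewrite mulrDl mulr_natl.
rewrite -addrA -[LHS]addr0 => /addrI/esym/eqP.
rewrite addr_eq0 => /eqP ->; congr (- _).
by apply: eq_bigr => l _; rewrite addSnnS.
Qed.

End newton.

Section roots_measurable.
Context d (U : measurableType d) (R : realType) (N : nat).
Variable Z : 'I_N -> U -> R[i].
Hypothesis power_sums : forall k, (0 < k <= N)%N ->
  cmeasurable (fun t => \sum_j Z j t ^+ k).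

Let p t := \prod_j ('X - (Z j t)%:P).

Let size_p t : size (p t) = N.+1.
Proof. by rewrite /p -big_enum/= size_prod_XsubC -cardE card_ord. Qed.

Lemma cmeasurable_coef_root_poly q k : (k + q = N)%N ->
  cmeasurable (fun t => (p t)`_k).
Proof.
elim/ltn_ind: q k => -[|q] IH k kq.
  rewrite (_ : (fun t => _) = fun=> 1); first exact: cmeasurable_cst.
  apply/funext => t; have /monicP := monic_prod_XsubC (index_enum 'I_N) xpredT
    (fun j => Z j t).
  by rewrite /lead_coef -/(p t) size_p/= -kq addn0.
rewrite (_ : (fun t => _) = fun t => - q.+1%:R^-1 *
    \sum_(i < q.+1) (\sum_j Z j t ^+ i.+1) * (p t)`_(k + i.+1)).
  apply: cmeasurableM; first exact: cmeasurable_cst.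
  apply: cmeasurable_sum => i; apply: cmeasurableM.
    by apply: power_sums => /=; rewrite -kq (leq_trans (ltn_ord i))// leq_addl.
  apply: (IH (q - i)%N); first by rewrite ltnS leq_subr.
  by have := ltn_ord i; lia.
apply/funext => t; have := newton_identities (fun j => Z j t) kq.
by rewrite -/(p t) => h; rewrite mulNr -mulrN -h mulKf.
Qed.

Lemma cmeasurable_prod_root x : cmeasurable (fun t => \prod_j (x - Z j t)).
Proof.
rewrite (_ : (fun t => _) = fun t => \sum_(k < N.+1) (p t)`_k * x ^+ k).
  apply: cmeasurable_sum => k; apply: cmeasurableM; last exact: cmeasurable_cst.
  apply: (@cmeasurable_coef_root_poly (N - k)).
  by rewrite addnC subnK// -ltnS.
apply/funext => t; rewrite -[in RHS](size_p t) -horner_coef /p horner_prod.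
by apply: eq_bigr => j _; rewrite hornerXsubC.
Qed.

End roots_measurable.

(** * The topology of the complex plane *)

Section complex_plane.
Context {R : realType}.
Implicit Types (z w : R[i]) (O : set (R[i])^o).

Lemma open_normcP O z : open O -> O z ->
  exists2 e : R, 0 < e & forall w, normc (w - z) < e -> O w.
Proof.
move=> oO Oz; have /nbhs_ballP[e /= e0 He] : nbhs (z : (R[i])^o) O.
  exact: open_nbhs_nbhs.
have [/eqP ie re] : Im e == 0 /\ 0 < Re e.
  by move: e0; rewrite ltcE => /andP[].
exists (Re e) => // w wz; apply: He; rewrite /ball/= distrC.
by rewrite ltcE /= ie eqxx.
Qed.

Definition disc z (e : R) : set (R[i])^o := [set w | normc (w - z) < e].

Lemma open_disc z (e : R) : open (disc z e).
Proof.
rewrite /disc.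
have [e0|e0] := ltP 0 e; last first.
  rewrite (_ : mkset _ = set0); first exact: open0.
  apply/seteqP; split => // w /= h.
  by have := lt_le_trans h e0; rewrite ltNge normc_ge0.
rewrite (_ : mkset _ = ball (z : (R[i])^o) e%:C); first exact: ball_open.
apply/seteqP; split => w /=; rewrite /ball/= distrC ltcE/=.
  by rewrite eqxx.
by move=> /andP[].
Qed.

Lemma dense_rat_complex z (e : R) : 0 < e ->
  exists ab : rat * rat, normc (z - (ratr ab.1 +i* ratr ab.2)) < e.
Proof.
move=> e0.
have near (x : R) : exists a : rat, `|x - ratr a| < e / 2.
  have /rat_in_itvoo[a] : x - e / 2 < x + e / 2 by rewrite ltrD2l gtrN// divr_gt0.
  rewrite in_itv/= => /andP[a1 a2]; exists a; rewrite ltr_norml.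
  by apply/andP; split; lra.
have [a ha] := near (Re z); have [b hb] := near (Im z); exists (a, b).
apply: le_lt_trans (normc_le _) _; rewrite ReD ImD ReN ImN/=.
by rewrite [ltRHS]splitr ltrD.
Qed.

End complex_plane.

(** If [\prod_j |x - Z j| < e ^ N] then some root is within [e] of [x], and the
    product is arbitrarily small when [x] is close enough to a root.  With
    rational [x] and discs of radius [e = 1 / (L + 1)] contained in [O], this
    writes the set as a countable union of sets defined by symmetric functions
    of the roots. *)
Lemma measurable_some_root d (U : measurableType d) (R : realType) (N : nat)
    (Z : 'I_N -> U -> R[i]) :
  (forall k, (0 < k <= N)%N -> cmeasurable (fun t => \sum_j Z j t ^+ k)) ->
  forall O : set (R[i])^o, open O -> measurable [set t | exists j, O (Z j t)].
Proof.
move=> hZ O oO.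
pose x (ab : rat * rat) : R[i] := ratr ab.1 +i* ratr ab.2.
pose q ab t := normc (\prod_j (x ab - Z j t)).
pose h (L : nat) : R := L.+1%:R^-1.
have h0 L : 0 < h L by rewrite invr_gt0.
pose good (u : nat * (rat * rat)) :=
  forall w, normc (w - x u.2) < h u.1 -> O w.
pose F (u : nat * (rat * rat)) :=
  [set t | good u /\ q u.2 t < h u.1 ^+ N].
rewrite (_ : mkset _ = \bigcup_u F u); last first.
  apply/seteqP; split => t /=.
  - move=> [j Oj]; have [e e0 He] := open_normcP oO Oj.
    have [L hL] : exists L, h L < e / 2.
      have e20 : 0 < e / 2 by rewrite divr_gt0.
      have [L _ /(_ L (leqnn _))] :=
        (cvgr0Pnorm_lt _).1 (@cvg_harmonic R) _ e20.
      by rewrite /= ger0_norm//; exists L.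
    (* [M] bounds every factor, so that a single small factor makes the whole
       product small. *)
    pose M := 1 + \sum_l normc (Z j t - Z l t).
    have M1 : 1 <= M.
      by rewrite lerDl sumr_ge0// => l _; exact: normc_ge0.
    have M0 : 0 < M by rewrite (lt_le_trans ltr01).
    pose de := Num.min (Num.min (e / 2) 1) (h L ^+ N / M ^+ N).
    have de0 : 0 < de.
      by rewrite !lt_min !divr_gt0//= ?ltr01 ?exprn_gt0.
    have [ab hab] := dense_rat_complex (Z j t) de0.
    have : de <= de by []. rewrite {2}/de !le_min => /andP[/andP[de1 de2] de3].
    exists (L, ab) => //; split => /=.
      move=> w wx; apply: He.
      have -> : w - Z j t = (w - x ab) + (x ab - Z j t) by ring.
      apply: le_lt_trans (le_normcD _ _) _; rewrite [ltRHS]splitr ltrD//.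
        exact: lt_trans wx hL.
      by rewrite -normcN opprB (lt_le_trans hab).
    rewrite /q normc_prod (bigD1 j)//= -normcN opprB.
    have prodM : \prod_(l | l != j) normc (x ab - Z l t) <= M ^+ N.
      apply: (@le_trans _ _ (\prod_(l | l != j) M)).
        apply: ler_prod => l _; rewrite normc_ge0/=.
        have -> : x ab - Z l t = - (Z j t - x ab) + (Z j t - Z l t) by ring.
        apply: le_trans (le_normcD _ _) _; rewrite normcN lerD//.
          by rewrite (le_trans (ltW hab)).
        by rewrite (bigD1 l)//= lerDl sumr_ge0// => i _; exact: normc_ge0.
      rewrite prodr_const ler_weXn2l//.
      by rewrite (leq_trans (max_card _))// card_ord.
    apply: le_lt_trans (_ : normc (Z j t - x ab) * M ^+ N < _).
      by rewrite ler_wpM2l ?normc_ge0.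
    by rewrite -ltr_pdivlMr ?exprn_gt0// (lt_le_trans hab).
  - move=> [[L ab] _ [/= gd]]; rewrite /q normc_prod => small.
    have [[j hj]|far] := pselect (exists j, normc (x ab - Z j t) < h L).
      by exists j; apply: gd => /=; rewrite -normcN opprB.
    exfalso; move: small; apply/negP; rewrite -leNgt.
    rewrite -[X in h L ^+ X](card_ord N) -prodr_const.
    apply: ler_prod => j _; rewrite ltW//= leNgt; apply/negP => hj.
    by apply: far; exists j.
apply: countable_bigcupT_measurable => //.
move=> [L ab]; have [gd|ngd] := pselect (good (L, ab)); last first.
  by rewrite (_ : F _ = set0)//; apply/seteqP; split => // t [].
rewrite (_ : F _ = (q ab) @^-1` `]-oo, (h L ^+ N)[%classic).
  rewrite -[X in measurable X]setTI; apply: measurable_normc => //.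
  exact: cmeasurable_prod_root.
by apply/seteqP; split => t /=; rewrite in_itv/=; [case|split].
Qed.

(** * Imaginary exponentials as limits of analytic times antianalytic *)

Section phase.
Context {R : realType}.
Implicit Types (x y : R) (w z : R[i]).

Definition cis x : R[i] := cos x +i* sin x.

Lemma cisD x y : cis (x + y) = cis x * cis y.
Proof.
by apply: complex_eq; rewrite ?ReM ?ImM /= ?cosD// sinD addrC.
Qed.

Lemma cis0 : cis 0 = 1.
Proof. by apply: complex_eq => /=; rewrite ?cos0 ?sin0. Qed.

Lemma cisMn x n : cis (n%:R * x) = cis x ^+ n.
Proof.
elim: n => [|n IH]; first by rewrite mul0r cis0 expr0.
by rewrite -natr1 mulrDl mul1r cisD IH exprSr.
Qed.

Lemma normc_cis x : normc (cis x) = 1.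
Proof. by rewrite /= cos2Dsin2 sqrtr1. Qed.

Lemma cis_sum I (s : seq I) (P : pred I) (F : I -> R) :
  cis (\sum_(i <- s | P i) F i) = \prod_(i <- s | P i) cis (F i).
Proof. by apply: (big_morph cis cisD cis0). Qed.

Lemma normc_subX_le (a b : R[i]) (B : R) n :
  (forall k, (k <= n)%N -> normc a ^+ k <= B) -> normc b = 1 ->
  normc (a ^+ n - b ^+ n) <= n%:R * normc (a - b) * B.
Proof.
move=> aB b1; rewrite subrXX ComplexField.Normc.normcM.
rewrite [n%:R * _]mulrC -mulrA ler_wpM2l ?normc_ge0//.
apply: le_trans (normc_sum _ _ _) _.
rewrite mulr_natl -[X in _ *+ X](card_ord n) -sumr_const.
apply: ler_sum => i _; rewrite ComplexField.Normc.normcM !normcX b1 expr1n mulr1.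
by apply: aB; lia.
Qed.

(** The product of a polynomial in [w] and a conjugate polynomial whose power
    [m + 1] tends to [exp (w / 2) * exp (- w^* / 2) = cis (Im w)]. *)
Definition phase_factor w (m : nat) : R[i] :=
  (1 + w * ((2 * m.+1%:R)^-1)%:C) * (1 - w * ((2 * m.+1%:R)^-1)%:C)^*.

Lemma normc_phase_factor w m k : (k <= m.+1)%N ->
  normc (phase_factor w m) ^+ k <= expR (normc w).
Proof.
move=> km; pose t := normc w / (2 * m.+1%:R).
have t0 : 0 <= t by rewrite divr_ge0 ?normc_ge0// mulr_ge0.
have nE : normc (w * ((2 * m.+1%:R)^-1)%:C) = t.
  have i0 : 0 <= (2 * m.+1%:R : R)^-1 by rewrite invr_ge0 mulr_ge0.
  by rewrite ComplexField.Normc.normcM normc_real ger0_norm.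
have le1 : normc (phase_factor w m) <= (1 + t) ^+ 2.
  rewrite ComplexField.Normc.normcM normc_conj expr2.
  have n1 : normc (1 : R[i]) = 1 := ComplexField.Normc.normc1 _.
  apply: ler_pM; rewrite ?normc_ge0//.
    by rewrite (le_trans (le_normcD _ _))// n1 nE.
  by rewrite (le_trans (le_normcD _ _))// normcN n1 nE.
apply: (@le_trans _ _ (((1 + t) ^+ 2) ^+ k)).
  by rewrite lerXn2r ?nnegrE ?normc_ge0 ?exprn_ge0 ?addr_ge0.
rewrite -exprM; apply: (@le_trans _ _ ((1 + t) ^+ (2 * m.+1))).
  by rewrite ler_weXn2l ?lerDl// leq_mul2l.
apply: (@le_trans _ _ (expR t ^+ (2 * m.+1))).
  by rewrite lerXn2r ?nnegrE ?expR_ge0 ?addr_ge0 ?expR_ge1Dx.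
by rewrite -expRM_natl ler_expR /t natrM mulrCA divff ?mulr1.
Qed.

Lemma phase_factorE w m : phase_factor w m =
  (1 - normc w ^+ 2 / 4 / m.+1%:R ^+ 2) +i* (Im w / m.+1%:R).
Proof.
rewrite /phase_factor normc_sqr; case: w => a b.
by apply: complex_eq;
  rewrite !(ReM, ReD, ImM, ImD, Re_conj, Im_conj, ReN, ImN)/=; field.
Qed.

(** The factor differs from [cis (Im w / (m + 1))] by [o(1 / m)], and powers
    of uniformly power-bounded numbers are compared by telescoping. *)
Lemma cvg_phase_factor w :
  ccvg (fun m => phase_factor w m ^+ m.+1) (cis (Im w)).
Proof.
apply: ccvg_normc.
pose th := Im w; pose s := normc w ^+ 2 / 4.
have dsin : is_derive (0 : R) 1 (@sin R) 1.
  by have := is_derive_sin (0 : R); rewrite cos0.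
have dcos : is_derive (0 : R) 1 (@cos R) 0.
  by have := is_derive_cos (0 : R); rewrite sin0 oppr0.
have := @cvg_difference_quotient R (@sin R) 1 th dsin.
rewrite sin0 mulr1 => lims.
have := @cvg_difference_quotient R (@cos R) 0 th dcos.
rewrite cos0 mulr0 => limc.
have lim : (fun m => (`| - s * m.+1%:R^-1 - m.+1%:R * (cos (th / m.+1%:R) - 1)|
    + `| th - m.+1%:R * (sin (th / m.+1%:R) - 0)|) * expR (normc w))
    @ \oo --> (0 : R).
  rewrite -[X in _ --> X](mul0r (expR (normc w))).
  apply: cvgM; last exact: cvg_cst.
  have E : `|0 : R| + `|0 : R| = 0 by rewrite normr0 addr0.
  rewrite -[X in _ --> X]E.
  apply: cvgD; apply: cvg_norm.
    rewrite -[X in _ --> X]subr0 -[X in _ --> X - _](mulr0 (- s)).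
    apply: cvgB; last exact: limc.
    by apply: cvgM; [exact: cvg_cst|exact: cvg_harmonic].
  rewrite -[X in _ --> X](subrr th).
  by apply: cvgB; [exact: cvg_cst|exact: lims].
apply: squeeze_cvgr (cvg_cst _) lim; apply: nearW => m.
rewrite normc_ge0/=.
have -> : cis (Im w) = cis (th / m.+1%:R) ^+ m.+1.
  by rewrite -cisMn mulrCA divff ?mulr1.
apply: le_trans (normc_subX_le (@normc_phase_factor w m) (normc_cis _)) _.
rewrite ler_wpM2r ?expR_ge0//.
apply: le_trans (ler_wpM2l _ (normc_le _)) _ => //.
have nM (x : R) : m.+1%:R * `|x| = `|m.+1%:R * x|.
  by rewrite normrM [`|m.+1%:R|]ger0_norm.
rewrite mulrDr !nM phase_factorE -/s -/th.
rewrite le_eqVlt; apply/orP; left; apply/eqP.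
congr (_ + _); congr (Num.norm _); rewrite !(ReD, ImD, ReN, ImN)/=.
  by field.
by rewrite subr0 mulrBr mulrCA divff ?mulr1.
Qed.

End phase.

(** * Densities of finite rank *)

Section growth.
Context {R : realType}.
Implicit Types (s : R) (p : {poly R[i]}).

Lemma expn_le_expR (r k : nat) (e : R) : (0 < r)%N -> 0 < e ->
  exists2 C : R, 0 <= C & forall s, 0 <= s -> s ^+ k <= C * expR (e * s ^+ r).
Proof.
move=> r0 e0; exists (1 + e ^- k * k`!%:R).
  by rewrite addr_ge0// mulr_ge0// invr_ge0 exprn_ge0// ltW.
move=> s s0; have x0 : 0 <= e * s ^+ r by rewrite mulr_ge0 ?exprn_ge0// ltW.
have E1 : 1 <= expR (e * s ^+ r) by rewrite -expR0 ler_expR.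
have ek0 : 0 < e ^+ k by rewrite exprn_gt0.
rewrite mulrDl mul1r.
have h0 : 0 <= e ^- k * k`!%:R * expR (e * s ^+ r).
  by rewrite !mulr_ge0 ?expR_ge0// invr_ge0 ltW.
have [s1|s1] := leP s 1.
  rewrite (le_trans (_ : _ <= 1)) ?exprn_ile1//.
  by rewrite (le_trans E1)// lerDl.
have [k0|k0] := posnP k; first by rewrite {1}k0 expr0 (le_trans E1)// lerDl.
apply: (@le_trans _ _ ((s ^+ r) ^+ k)).
  by rewrite -exprM ler_weXn2l ?ltW// leq_pmull.
have := expR_ge1Dxn k.-1 x0; rewrite prednK// => h.
have h' : (e * s ^+ r) ^+ k <= k`!%:R * expR (e * s ^+ r).
  rewrite [leRHS]mulrC -ler_pdivrMr ?ltr0n ?fact_gt0//.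
  by rewrite (le_trans _ h)// lerDr.
apply: le_trans (_ : e ^- k * (k`!%:R * expR (e * s ^+ r)) <= _).
  by rewrite mulrC ler_pdivlMr// mulrC -exprMn.
by rewrite mulrA lerDr expR_ge0.
Qed.

Lemma normc_horner p (z : R[i]) :
  normc p.[z] <= \sum_(i < size p) normc p`_i * normc z ^+ i.
Proof.
rewrite horner_coef (le_trans (normc_sum _ _ _))//; apply: ler_sum => i _.
by rewrite ComplexField.Normc.normcM normcX.
Qed.

Lemma horner_le_expR (r : nat) p (e : R) : (0 < r)%N -> 0 < e ->
  exists2 C : R, 0 <= C &
    forall z, normc p.[z] <= C * expR (e * normc z ^+ r).
Proof.
move=> r0 e0.
pose C k := sval (cid2 (expn_le_expR k r0 e0)).
have C0 k : 0 <= C k by rewrite /C; case: cid2.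
have CP k s : 0 <= s -> s ^+ k <= C k * expR (e * s ^+ r).
  by rewrite /C; case: cid2 => c /= _; apply.
exists (\sum_(i < size p) normc p`_i * C i).
  by rewrite sumr_ge0// => i _; rewrite mulr_ge0 ?normc_ge0.
move=> z; rewrite (le_trans (normc_horner _ _))// mulr_suml ler_sum// => i _.
by rewrite -mulrA ler_wpM2l ?normc_ge0// CP// normc_ge0.
Qed.

Lemma horner_le_pow (r : nat) p : (size p <= r.+1)%N ->
  exists2 A : R, 0 <= A & forall z, normc p.[z] <= A * (1 + normc z ^+ r).
Proof.
move=> pr; exists (\sum_(i < size p) normc p`_i).
  by rewrite sumr_ge0// => i _; rewrite normc_ge0.
move=> z; rewrite (le_trans (normc_horner _ _))// mulr_suml ler_sum// => i _.
rewrite ler_wpM2l ?normc_ge0//; have s0 := normc_ge0 z.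
have [s1|s1] := leP (normc z) 1.
  by rewrite (le_trans (_ : _ <= 1)) ?exprn_ile1// lerDl exprn_ge0.
apply: (@le_trans _ _ (normc z ^+ r)); last by rewrite lerDr.
by rewrite ler_weXn2l ?ltW// -ltnS (leq_trans (ltn_ord i)).
Qed.

End growth.

Section finite_rank.
Context d (X : measurableType d) (R : realType).
Variables (mu : {measure set X -> \bar R}) (Z : X -> R[i]) (r : nat).
Variables (gamma : R) (N : nat).
Hypothesis mZ : cmeasurable Z.
Hypothesis r0 : (0 < r)%N.
Hypothesis gamma0 : 0 < gamma.
Hypothesis exp_moment :
  mu.-integrable setT (EFin \o (fun x => expR (gamma * normc (Z x) ^+ r))).
Implicit Types (h : X -> R[i]) (Q u v : {poly R[i]}).

Definition unit_bounded h := cmeasurable h /\ forall x, normc (h x) <= 1.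

Definition moment_fun h u v := fun x => u.[Z x] * (v.[Z x])^* * h x.

(** Rank less than [N] is expressed by determinants, because these pass to the
    limit when the polynomials vary. *)
Definition rank_lt h := forall u v : 'I_N -> {poly R[i]},
  \det (\matrix_(j < N, k < N) cint mu (moment_fun h (u j) (v k))) = 0.

Lemma cmeasurable_moment_fun h u v :
  cmeasurable h -> cmeasurable (moment_fun h u v).
Proof.
move=> mh; apply: cmeasurableM => //; apply: cmeasurableM.
  exact: cmeasurable_horner.
by apply: cmeasurable_conj; exact: cmeasurable_horner.
Qed.

(** The weight [exp (gamma |z| ^ r)] is shared out: a quarter for each
    polynomial and a quarter for the twist. *)
Lemma horner_mul_le_exp u v : exists2 C : R, 0 <= C & forall z,
  normc u.[z] * normc v.[z] * expR (gamma / 4 * (1 + normc z ^+ r)) <=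
  C * expR (gamma * normc z ^+ r).
Proof.
have g40 : 0 < gamma / 4 by rewrite divr_gt0.
have [Cu Cu0 hu] := horner_le_expR u r0 g40.
have [Cv Cv0 hv] := horner_le_expR v r0 g40.
exists (Cu * Cv * expR (gamma / 4)).
  by rewrite !mulr_ge0 ?expR_ge0.
move=> z; pose s := normc z ^+ r; have s0 : 0 <= s by rewrite exprn_ge0 ?normc_ge0.
apply: (@le_trans _ _ ((Cu * expR (gamma / 4 * s)) * (Cv * expR (gamma / 4 * s))
    * expR (gamma / 4 * (1 + s)))).
  by rewrite ler_wpM2r ?expR_ge0// ler_pM ?normc_ge0.
rewrite (_ : _ * expR _ = Cu * Cv * (expR (gamma / 4 * s) *
  expR (gamma / 4 * s) * expR (gamma / 4 * (1 + s)))); last by ring.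
rewrite -[leRHS]mulrA ler_wpM2l ?mulr_ge0// -!expRD ler_expR.
have : 0 <= gamma * s by rewrite mulr_ge0 // ltW.
rewrite -/s; lra.
Qed.

Let integrable_C (C : R) : mu.-integrable setT
  (EFin \o (fun x => C * expR (gamma * normc (Z x) ^+ r))).
Proof. exact: integrable_EFinZ. Qed.

Lemma cintegrable_moment_fun h u v :
  unit_bounded h -> cintegrable mu (moment_fun h u v).
Proof.
move=> [mh h1]; have [C C0 hC] := horner_mul_le_exp u v.
apply: cintegrable_le (integrable_C C) _; first exact: cmeasurable_moment_fun.
move=> x; apply: le_trans (hC (Z x)).
rewrite !ComplexField.Normc.normcM normc_conj ler_pM ?mulr_ge0 ?normc_ge0//.
rewrite (le_trans (h1 x))// -expR0 ler_expR mulr_ge0 ?addr_ge0//.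
  by rewrite divr_ge0// ltW.
by rewrite exprn_ge0 ?normc_ge0.
Qed.

Definition twist Q h := fun x => h x * cis (Im Q.[Z x]).

Lemma unit_bounded_twist Q h : unit_bounded h -> unit_bounded (twist Q h).
Proof.
move=> [mh h1]; split.
  have [_ mI] := cmeasurable_horner Q mZ.
  apply: cmeasurableM => //; split => /=.
    exact: (measurableT_comp (continuous_measurable_fun (@continuous_cos R)) mI).
  exact: (measurableT_comp (continuous_measurable_fun (@continuous_sin R)) mI).
by move=> x; rewrite ComplexField.Normc.normcM normc_cis mulr1.
Qed.

(** The twist is the limit of products [a m * (b m)^*] with [a m] and [b m]
    polynomials; they are dominated by [expR (normc Q)], which a quarter of the
    weight controls, so the determinants converge. *)
Lemma rank_lt_twist_small Q h :
  (forall z, normc Q.[z] <= gamma / 4 * (1 + normc z ^+ r)) ->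
  unit_bounded h -> rank_lt h -> rank_lt (twist Q h).
Proof.
move=> Qsmall bh rh u v.
have [mh h1] := bh.
pose c (m : nat) : R[i] := ((2 * m.+1%:R)^-1)%:C.
pose a m := (1 + Q * (c m)%:P) ^+ m.+1.
pose b m := (1 - Q * (c m)%:P) ^+ m.+1.
have factE m x : (a m).[Z x] * ((b m).[Z x])^* =
    phase_factor Q.[Z x] m ^+ m.+1.
  rewrite /a /b !horner_exp !hornerE /= rmorphXn/= -exprMn.
  by rewrite /phase_factor -/(c m).
have funE m j k x : moment_fun h (u j * a m) (v k * b m) x =
    moment_fun h (u j) (v k) x * phase_factor Q.[Z x] m ^+ m.+1.
  rewrite /moment_fun -factE !hornerM rmorphM /=; ring.
have cvg_entry j k : ccvg
    (fun m => cint mu (moment_fun h (u j * a m) (v k * b m)))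
    (cint mu (moment_fun (twist Q h) (u j) (v k))).
  have [C C0 hC] := horner_mul_le_exp (u j) (v k).
  apply: (ccvg_cint _ _ (integrable_C C) _).2.
  - by move=> m; exact: cmeasurable_moment_fun.
  - move=> x; under eq_fun do rewrite funE.
    have -> : moment_fun (twist Q h) (u j) (v k) x =
        moment_fun h (u j) (v k) x * cis (Im Q.[Z x]).
      by rewrite /moment_fun /twist !mulrA.
    by apply: ccvgM; [exact: ccvg_cst|exact: cvg_phase_factor].
  - move=> m x; rewrite funE; apply: le_trans (hC (Z x)).
    rewrite !ComplexField.Normc.normcM normc_conj normcX.
    rewrite ler_pM ?mulr_ge0 ?normc_ge0 ?exprn_ge0 ?normc_ge0//.
      by rewrite ler_piMr ?mulr_ge0 ?normc_ge0.
    by rewrite (le_trans (normc_phase_factor _ (leqnn _)))// ler_expR.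
have det0 m : \det (\matrix_(j < N, k < N)
    cint mu (moment_fun h (u j * a m) (v k * b m))) = 0 by exact: rh.
apply: (@ccvg_unique _ (fun=> 0) _ _ _ (ccvg_cst _)).
rewrite -(_ : (fun m => \det (\matrix_(j < N, k < N)
    cint mu (moment_fun h (u j * a m) (v k * b m)))) = fun=> 0); last exact/funext.
rewrite /determinant; apply: ccvg_sum => s; apply: ccvgM; first exact: ccvg_cst.
apply: ccvg_prod => i; rewrite mxE.
by under eq_fun do rewrite mxE.
Qed.

(** [Q] is cut into [K] equal pieces small enough for [rank_lt_twist_small].
    Each twist has modulus one, so the same weight serves at every step. *)
Lemma rank_lt_twist Q h : (size Q <= r.+1)%N ->
  unit_bounded h -> rank_lt h -> rank_lt (twist Q h).
Proof.
move=> sQ bh rh.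
have [A A0 hA] := horner_le_pow sQ.
have g40 : 0 < gamma / 4 by rewrite divr_gt0.
pose K := (Num.trunc (A / (gamma / 4))).+1.
have K0 : 0 < K%:R :> R by [].
have AK : A / K%:R <= gamma / 4.
  rewrite ler_pdivrMr// mulrC -ler_pdivrMr// ltW//.
  by rewrite /K; apply: truncnS_gt.
pose Q' := Q * ((K%:R^-1)%:C)%:P.
have Q'E z : Q'.[z] = Q.[z] * (K%:R^-1)%:C by rewrite hornerM hornerC.
have Q'small z : normc Q'.[z] <= gamma / 4 * (1 + normc z ^+ r).
  rewrite Q'E ComplexField.Normc.normcM normc_real gtr0_norm ?invr_gt0//.
  have s0 : 0 <= 1 + normc z ^+ r by rewrite addr_ge0 ?exprn_ge0 ?normc_ge0.
  apply: le_trans (ler_wpM2r _ (hA z)) _; first by rewrite invr_ge0.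
  by rewrite mulrAC ler_wpM2r.
have iterP n :
    unit_bounded (iter n (twist Q') h) /\ rank_lt (iter n (twist Q') h).
  elim: n => [|n [b1 r1]] //=; split; first exact: unit_bounded_twist.
  exact: rank_lt_twist_small.
have iterE n : iter n (twist Q') h = fun x => h x * cis (Im Q'.[Z x]) ^+ n.
  elim: n => [|n IH]; apply/funext => x /=; first by rewrite expr0 mulr1.
  by rewrite {1}/twist IH exprSr mulrA.
have -> : twist Q h = iter K (twist Q') h; last by case: (iterP K).
rewrite iterE; apply/funext => x; rewrite /twist -cisMn; congr (_ * cis _).
by rewrite Q'E ImM/= mulr0 add0r mulrCA divff ?mulr1// gt_eqF.
Qed.

End finite_rank.

(** * The determinant trick *)

Section determinant_trick.
Context d (X : measurableType d) (R : realType).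
Variables (mu : {finite_measure set X -> \bar R}) (Z : X -> R[i]) (r : nat).
Variables (gamma : R) (N : nat).
Hypothesis mZ : cmeasurable Z.
Hypothesis mZB : measurable_fun setT (Z : X -> borelC R).
Hypothesis r0 : (0 < r)%N.
Hypothesis gamma0 : 0 < gamma.
Hypothesis exp_moment :
  mu.-integrable setT (EFin \o (fun x => expR (gamma * normc (Z x) ^+ r))).
Variable h : X -> R[i].
Hypothesis h_bounded : unit_bounded h.
Hypothesis h_rank : rank_lt mu Z N h.
Hypothesis Nr : (N <= r)%N.
Implicit Types (A O : 'I_N -> set (R[i])^o) (s : {perm 'I_N}).

Definition restr (S : set (R[i])^o) : X -> R[i] := fun x => h x * (\1_S (Z x))%:C.

Definition moment (S : set (R[i])^o) (j k : nat) : R[i] :=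
  cint mu (moment_fun Z (restr S) 'X^j 'X^k).

Definition vandermonde (z : 'I_N -> R[i]) : R[i] :=
  \det (\matrix_(i < N, j < N) z i ^+ j).

(** The integral of [|vandermonde|^2] against the product of the restrictions
    of the measure [h mu] to the sets [A i], expanded by Leibniz's formula. *)
Definition vandermonde_mass A : R[i] :=
  \sum_(s : {perm 'I_N}) \sum_(t : {perm 'I_N}) (-1) ^+ s * (-1) ^+ t *
    \prod_i moment (A i) (s i) (t i).

Lemma vandermonde_sqr (z : 'I_N -> R[i]) :
  vandermonde z * (vandermonde z)^* =
  \sum_(s : {perm 'I_N}) \sum_(t : {perm 'I_N}) (-1) ^+ s * (-1) ^+ t *
    \prod_i (z i ^+ s i * (z i ^+ t i)^*).
Proof.
rewrite /vandermonde /determinant rmorph_sum mulr_suml; apply: eq_bigr => s _.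
rewrite mulr_sumr; apply: eq_bigr => t _.
rewrite rmorphM rmorph_sign rmorph_prod mulrACA big_split/=.
by congr (_ * (_ * _)); apply: eq_bigr => i _; rewrite mxE.
Qed.

Lemma vandermonde_neq0 (z : 'I_N -> R[i]) : injective z -> vandermonde z != 0.
Proof.
move=> inj_z; rewrite /vandermonde.
have -> : \matrix_(i < N, j < N) z i ^+ j = (Vandermonde N (\row_i z i))^T.
  by apply/matrixP => i j; rewrite !mxE.
rewrite det_tr det_Vandermonde; apply/prodf_neq0 => i _.
apply/prodf_neq0 => j ij; rewrite !mxE subr_eq0.
by apply: contraTneq ij => /inj_z ->; rewrite ltnn.
Qed.

Lemma restr_preimage (S : set (R[i])^o) : measurable (S : set (borelC R)) ->
  measurable (Z @^-1` S).
Proof. by move=> mS; rewrite -[X in measurable X]setTI; exact: mZB. Qed.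

Lemma unit_bounded_restr (S : set (R[i])^o) :
  measurable (S : set (borelC R)) -> unit_bounded (restr S).
Proof.
move=> mS; have [mh h1] := h_bounded; split.
  apply: cmeasurableM => //.
  exact: (cmeasurable_indic R (restr_preimage mS)).
move=> x; rewrite ComplexField.Normc.normcM normc_real indicE.
rewrite -[leRHS]mulr1; apply: ler_pM; rewrite ?normc_ge0//.
by rewrite ger0_norm// lern1 leq_b1.
Qed.

Lemma open_measurable (S : set (R[i])^o) : open S -> measurable (S : set (borelC R)).
Proof. exact: sub_sigma_algebra. Qed.

Lemma vandermonde_mass_perm A (s : {perm 'I_N}) :
  vandermonde_mass (fun i => A (s i)) = vandermonde_mass A.
Proof.
rewrite /vandermonde_mass (reindex_inj (mulgI s)); apply: eq_bigr => s' _.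
rewrite (reindex_inj (mulgI s)); apply: eq_bigr => t' _.
rewrite !odd_permM (signr_addb _ s s') (signr_addb _ s t') mulrACA.
rewrite -(signr_addb _ s s) addbb mul1r; congr (_ * _).
rewrite [RHS](reindex_inj (@perm_inj _ s)).
by apply: eq_bigr => i _; rewrite !permM.
Qed.

Section power.
Context d' (T : measurableType d') (P : {finite_measure set T -> \bar R}).
Variable pr : 'I_N -> T -> X.
Hypothesis mpr : forall i, measurable_fun setT (pr i).
Hypothesis cint_pr : forall f : 'I_N -> X -> R[i],
  (forall i, cintegrable mu (f i)) ->
  cintegrable P (fun t => \prod_i f i (pr i t)) /\
  cint P (fun t => \prod_i f i (pr i t)) = \prod_i cint mu (f i).

Let V t := vandermonde (fun i => Z (pr i t)).

(** Both determinants in [|V|^2] are expanded, after which every term is a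
    product of functions of one variable. *)
Lemma cint_vandermonde (g : 'I_N -> X -> R[i]) :
  (forall i, unit_bounded (g i)) ->
  cintegrable P (fun w => V w * (V w)^* * \prod_i g i (pr i w)) /\
  cint P (fun w => V w * (V w)^* * \prod_i g i (pr i w)) =
  \sum_(s : {perm 'I_N}) \sum_(t : {perm 'I_N}) (-1) ^+ s * (-1) ^+ t *
    \prod_i cint mu (moment_fun Z (g i) 'X^(s i) 'X^(t i)).
Proof.
move=> bg.
have intm i j k : cintegrable mu (moment_fun Z (g i) 'X^j 'X^k).
  exact: (cintegrable_moment_fun mZ r0 gamma0 exp_moment).
pose F (s t : {perm 'I_N}) w := (-1) ^+ s * (-1) ^+ t *
   \prod_i moment_fun Z (g i) 'X^(s i) 'X^(t i) (pr i w).
have E : (fun w => V w * (V w)^* * \prod_i g i (pr i w)) =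
    fun w => \sum_(s : {perm 'I_N}) \sum_(t : {perm 'I_N}) F s t w.
  apply/funext => w; rewrite vandermonde_sqr mulr_suml; apply: eq_bigr => s _.
  rewrite mulr_suml; apply: eq_bigr => t _; rewrite /F -[LHS]mulrA -big_split/=.
  by congr (_ * _); apply: eq_bigr => i _; rewrite /moment_fun !hornerXn.
have iF s t : cintegrable P (F s t).
  by apply: cintegrableZ; have [] := cint_pr (fun i => intm i (s i) (t i)).
rewrite E; split.
  by apply: cintegrable_sum => s; apply: cintegrable_sum => t.
rewrite cint_sum => [|s]; last exact: cintegrable_sum.
apply: eq_bigr => s _; rewrite cint_sum//; apply: eq_bigr => t _.
have [i1 e1] := cint_pr (fun i => intm i (s i) (t i)).
by rewrite cintZ ?e1.
Qed.

Let H w := \prod_i h (pr i w).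
Let G w := V w * (V w)^* * H w.
Let theta (Q : {poly R[i]}) w := \sum_j Im Q.[Z (pr j w)].

Let mZpr i : cmeasurable (fun w => Z (pr i w)).
Proof.
case: mZ => a b; split; first exact: (measurableT_comp a (mpr i)).
exact: (measurableT_comp b (mpr i)).
Qed.

Let cintegrable_G : cintegrable P G.
Proof. by have [] := cint_vandermonde (fun=> h_bounded). Qed.

(** Exponents [Q] of degree at most [r] only change the density, so the
    determinants in Leibniz's expansion still vanish. *)
Let cint_G_cis (Q : {poly R[i]}) : (size Q <= r.+1)%N ->
  cint P (fun w => G w * cis (theta Q w)) = 0.
Proof.
move=> sQ; have bQ := unit_bounded_twist mZ Q h_bounded.
have rQ := rank_lt_twist mZ r0 gamma0 exp_moment sQ h_bounded h_rank.
have [_ e] := cint_vandermonde (fun=> bQ).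
rewrite (_ : (fun w => _) =
    fun w => V w * (V w)^* * \prod_i twist Z Q h (pr i w)); last first.
  by apply/funext => w; rewrite /G -mulrA /H cis_sum -big_split.
rewrite e big1// => s _.
have := rQ (fun j => 'X^(s j)) (fun k => 'X^k).
rewrite /determinant => e0.
rewrite -[RHS](mulr0 ((-1) ^+ s)) -[in RHS]e0 mulr_sumr; apply: eq_bigr => t _.
by rewrite mulrA; congr (_ * _); apply: eq_bigr => i _; rewrite mxE.
Qed.

Let trig_G (Q : {poly R[i]}) : (size Q <= r.+1)%N ->
  [/\ \int[P]_w (Re (G w) * cos (theta Q w)) = 0,
      \int[P]_w (Re (G w) * sin (theta Q w)) = 0,
      \int[P]_w (Im (G w) * cos (theta Q w)) = 0 &
      \int[P]_w (Im (G w) * sin (theta Q w)) = 0].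
Proof.
move=> sQ.
have thN w : theta (- Q) w = - theta Q w.
  by rewrite /theta -sumrN; apply: eq_bigr => j _; rewrite hornerN ImN.
have mth : measurable_fun setT (theta Q).
  have [_] := cmeasurable_sum (index_enum 'I_N) xpredT
    (fun j => cmeasurable_horner Q (mZpr j)).
  by rewrite /theta; under eq_fun do rewrite Im_sum.
have mcos : measurable_fun setT (fun w => cos (theta Q w)).
  exact: (measurableT_comp (continuous_measurable_fun (@continuous_cos R)) mth).
have msin : measurable_fun setT (fun w => sin (theta Q w)).
  exact: (measurableT_comp (continuous_measurable_fun (@continuous_sin R)) mth).
have int_mul (g k : T -> R) : P.-integrable setT (EFin \o g) ->
    measurable_fun setT k -> (forall w, `|k w| <= 1) ->
    P.-integrable setT (EFin \o (fun w => g w * k w)).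
  move=> ig mk k1.
  have mg : measurable_fun setT g by case/integrableP: ig => /measurable_EFinP.
  apply: le_integrable ig => //.
    by apply/measurable_EFinP; exact: measurable_funM.
  by move=> w _ /=; rewrite lee_fin normrM ler_piMr.
have [iR iI] := cintegrable_G.
have i1 := int_mul _ _ iR mcos (fun=> cos_max _).
have i2 := int_mul _ _ iR msin (fun=> sin_max _).
have i3 := int_mul _ _ iI mcos (fun=> cos_max _).
have i4 := int_mul _ _ iI msin (fun=> sin_max _).
have := cint_G_cis sQ; have : (size (- Q)%R <= r.+1)%N by rewrite size_polyN.
move=> /cint_G_cis; rewrite /cint.
move=> [e1 e2] [e3 e4]; move: e1 e2 e3 e4.
under eq_Rintegral do rewrite ReM/= thN cosN sinN mulrN opprK.
under [X in _ -> X = _ -> _]eq_Rintegral do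
  rewrite ImM/= thN cosN sinN mulrN addrC.
under [X in _ -> _ -> X = _ -> _]eq_Rintegral do rewrite ReM/=.
under [X in _ -> _ -> _ -> X = _ -> _]eq_Rintegral do rewrite ImM/=.
rewrite RintegralD// RintegralB// RintegralB// RintegralD// => a b c e.
by split; lra.
Qed.

(** Luecking's step: the power sums [\sum_j Z_j ^ k] with [k <= N] generate the
    events [some root lies in O], so these are invisible to [G]. *)
Let cint_G_roots O : (forall i, open (O i)) ->
  let B := [set w | forall i, exists j, O i (Z (pr j w))] in
  cintegrable P (fun w => G w * (\1_B w)%:C) /\
  cint P (fun w => G w * (\1_B w)%:C) = 0.
Proof.
move=> oO B.
pose Th := [set theta Q | Q in [set Q : {poly R[i]} | (size Q <= r.+1)%N]].
have mTh th : Th th -> measurable_fun setT th.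
  move=> [Q _ <-]; have [_] := cmeasurable_sum (index_enum 'I_N) xpredT
    (fun j => cmeasurable_horner Q (mZpr j)).
  by rewrite /theta; under eq_fun do rewrite Im_sum.
have ThD th th' : Th th -> Th th' -> Th (fun t => th t + th' t).
  move=> [Q sQ <-] [Q' sQ' <-]; exists (Q + Q').
    by rewrite /= (leq_trans (size_polyD _ _))// geq_max sQ.
  apply/funext => w; rewrite /theta -big_split; apply: eq_bigr => j _.
  by rewrite hornerD ImD.
have ThZ a th : Th th -> Th (fun t => a * th t).
  move=> [Q sQ <-]; exists (a%:C *: Q).
    by rewrite /= (leq_trans (size_scale_leq _ _)).
  apply/funext => w; rewrite /theta mulr_sumr; apply: eq_bigr => j _.
  by rewrite hornerZ ImM/= mul0r addr0.
have Th0 : Th (fun=> 0).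
  exists 0; first by rewrite /= size_poly0.
  by apply/funext => w; rewrite /theta big1// => j _; rewrite horner0.
have [iR iI] := cintegrable_G.
have powers (S : set (set T)) : (forall th, Th th ->
      measurable_fun (setT : set (g_sigma_algebraType S)) th) ->
    @measurable _ (g_sigma_algebraType S) B.
  move=> hS; pose U := g_sigma_algebraType S.
  have hroot (W : set (R[i])^o) : open W ->
      @measurable _ U [set w | exists j, W (Z (pr j w))].
    apply: (@measurable_some_root _ U R N (fun j w => Z (pr j w))).
    move=> k /andP[_ kN]; split.
      have /hS : Th (theta ('i%C *: 'X^k)).
        exists ('i%C *: 'X^k) => //=; rewrite (leq_trans (size_scale_leq _ _))//.
        by rewrite size_polyXn ltnS (leq_trans kN).
      rewrite /theta; under eq_fun do under eq_bigr do
        rewrite hornerZ hornerXn mulrC ImiRe.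
      by under [X in _ -> measurable_fun _ X]eq_fun do rewrite Re_sum.
    have /hS : Th (theta 'X^k).
      by exists ('X^k) => //=; rewrite size_polyXn ltnS (leq_trans kN).
    rewrite /theta; under eq_fun do under eq_bigr do rewrite hornerXn.
    by under [X in _ -> measurable_fun _ X]eq_fun do rewrite Im_sum.
  rewrite (_ : B = \bigcap_(i in [set: 'I_N])
      [set w | exists j, O i (Z (pr j w))]).
    by apply: fin_bigcap_measurable => // i _; exact: hroot.
  by apply/seteqP; split => w h1 i => [_|]; exact: h1.
have trig th : Th th ->
    [/\ \int[P]_w (Re (G w) * cos (th w)) = 0,
        \int[P]_w (Re (G w) * sin (th w)) = 0,
        \int[P]_w (Im (G w) * cos (th w)) = 0 &
        \int[P]_w (Im (G w) * sin (th w)) = 0].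
  by move=> [Q sQ <-]; exact: trig_G.
have [S1 [hS1 e1]] := trigonometric_uniqueness iR mTh ThD ThZ Th0
  (fun th Hth => let: And4 e _ _ _ := trig th Hth in e)
  (fun th Hth => let: And4 _ e _ _ := trig th Hth in e).
have [S2 [hS2 e2]] := trigonometric_uniqueness iI mTh ThD ThZ Th0
  (fun th Hth => let: And4 _ _ e _ := trig th Hth in e)
  (fun th Hth => let: And4 _ _ _ e := trig th Hth in e).
have [mB f1] := e1 _ (powers _ hS1); have [_ f2] := e2 _ (powers _ hS2).
split.
  have mB' : d'.-measurable B by exact: mB.
  have mI := @cmeasurable_indic _ T R B mB'.
  apply: (@cintegrableM _ T R P G _ 1 cintegrable_G mI) => w.
  by rewrite normc_real indicE ger0_norm// lern1 leq_b1.
apply: complex_eq => /=.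
  by under eq_Rintegral do rewrite ReM/= mulr0 subr0.
by under eq_Rintegral do rewrite ImM/= mulr0 add0r.
Qed.

(** Exactly one permutation matches [N] points with [N] disjoint sets that they
    all meet, so the event of [cint_G_roots] splits according to that
    permutation.  By symmetry the pieces have the same mass. *)
Lemma vandermonde_mass_open_power O : (forall i, open (O i)) ->
  (forall i j z, O i z -> O j z -> i = j) -> vandermonde_mass O = 0.
Proof.
move=> oO dO; have mO i := open_measurable (oO i).
have [intB0 B0] := cint_G_roots oO.
have termP s := cint_vandermonde (fun i => unit_bounded_restr (mO (s i))).
have sumE : (fun w => G w *
      (\1_[set w | forall i, exists j, O i (Z (pr j w))] w)%:C) =
    fun w => \sum_(s : {perm 'I_N})
      (V w * (V w)^* * \prod_i restr (O (s i)) (pr i w)).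
  apply/funext => w; rewrite -mulr_sumr /G -mulrA; congr (_ * _).
  under eq_bigr do rewrite /restr big_split/=.
  rewrite -mulr_sumr -/(H w); congr (_ * _); rewrite indicE.
  case: (boolP (w \in _)) => [|/negP nB]; last first.
    rewrite big1// => s _; apply/eqP/prodf_eq0.
    apply: contrapT => nz; apply: nB; rewrite inE/= => i.
    exists ((s^-1)%g i); apply: contrapT => nO; apply: nz.
    exists ((s^-1)%g i) => //; rewrite permKV.
    by rewrite indicE memNset.
  rewrite inE/= => hB; pose f i := sval (cid (hB i)).
  have fP i : O i (Z (pr (f i) w)) by rewrite /f; case: cid.
  have inj_f : injective f.
    by move=> i j e; apply: dO (fP i) _; rewrite e; exact: fP.
  pose s0 := perm inj_f.
  have sP i : O ((s0^-1)%g i) (Z (pr i w)).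
    have := fP ((s0^-1)%g i); by rewrite -(permE inj_f) -/s0 permKV.
  rewrite (bigD1 (s0^-1)%g)//= [X in _ = X + _]big1 => [|i _]; last first.
    by rewrite indicE mem_set//; exact: sP.
  rewrite big1 ?addr0// => s ns.
  have [i si] : exists i, s i != (s0^-1)%g i.
    apply: contrapT => h'; move/eqP: ns; apply; apply/permP => i.
    by apply/eqP/negPn/negP => ne; apply: h'; exists i.
  apply/eqP/prodf_eq0; exists i => //; rewrite indicE memNset// => Os.
  by move/eqP: si; apply; exact: dO Os (sP i).
move: B0; rewrite sumE cint_sum; last by move=> s; case: (termP s).
under eq_bigr => s _ do rewrite (termP s).2 -/(vandermonde_mass (fun i => O (s i)))
  vandermonde_mass_perm.
rewrite sumr_const -mulr_natl => /eqP; rewrite mulf_eq0 pnatr_eq0.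
by rewrite (cardD1 (1%g : {perm 'I_N}))/= => /eqP.
Qed.

End power.

Lemma vandermonde_mass_open O : (forall i, open (O i)) ->
  (forall i j z, O i z -> O j z -> i = j) -> vandermonde_mass O = 0.
Proof.
have [d' [T [P [pr [mpr cpr]]]]] := power_space mu N.
exact: (vandermonde_mass_open_power mpr cpr).
Qed.

(** ** From open to Borel sets *)

(** [vandermonde_mass] as a linear function of the moments of the [i]-th set
    alone. *)
Definition slice i A (m : nat -> nat -> R[i]) : R[i] :=
  \sum_(s : {perm 'I_N}) \sum_(t : {perm 'I_N}) (-1) ^+ s * (-1) ^+ t *
    (m (s i) (t i) * \prod_(l | l != i) moment (A l) (s l) (t l)).

Definition update A i (S : set (R[i])^o) : 'I_N -> set (R[i])^o :=
  fun l => if l == i then S else A l.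

Lemma vandermonde_mass_update A i S :
  vandermonde_mass (update A i S) = slice i A (moment S).
Proof.
apply: eq_bigr => s _; apply: eq_bigr => t _; congr (_ * _).
rewrite (bigD1 i)//= {1}/update eqxx; congr (_ * _).
by apply: eq_bigr => l li; rewrite /update (negbTE li).
Qed.

Lemma sliceD i A m m' :
  slice i A (fun j k => m j k + m' j k) = slice i A m + slice i A m'.
Proof.
rewrite -big_split; apply: eq_bigr => s _; rewrite -big_split.
by apply: eq_bigr => t _; rewrite mulrDl mulrDr.
Qed.

Lemma ccvg_slice i A (m_ : nat -> nat -> nat -> R[i]) m :
  (forall j k, ccvg (fun n => m_ n j k) (m j k)) ->
  ccvg (fun n => slice i A (m_ n)) (slice i A m).
Proof.
move=> hm; apply: ccvg_sum => s; apply: ccvg_sum => t.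
by apply: ccvgM; [exact: ccvg_cst|apply: ccvgM; [exact: hm|exact: ccvg_cst]].
Qed.

Lemma moment_bound (S : set (R[i])^o) j k x :
  normc (moment_fun Z (restr S) 'X^j 'X^k x) <=
  normc (moment_fun Z h 'X^j 'X^k x).
Proof.
rewrite /moment_fun /restr mulrA ComplexField.Normc.normcM ler_piMr ?normc_ge0//.
by rewrite normc_real indicE ger0_norm// lern1 leq_b1.
Qed.

Lemma momentU (S S' : set (R[i])^o) j k :
  measurable (S : set (borelC R)) -> measurable (S' : set (borelC R)) ->
  S `&` S' = set0 -> moment (S `|` S') j k = moment S j k + moment S' j k.
Proof.
move=> mS mS' dS; rewrite /moment -cintD.
- congr cint; apply/funext => x; rewrite /moment_fun /restr -mulrDr -mulrDr.
  rewrite -rmorphD /=; congr (_ * (_ * _%:C)); rewrite !indicE in_setU.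
  case: (boolP (Z x \in S)) => xS; case: (boolP (Z x \in S')) => xS';
    rewrite /= ?addr0 ?add0r//.
  have : (S `&` S') (Z x) by split; exact/set_mem.
  by rewrite dS.
- exact: (cintegrable_moment_fun mZ r0 gamma0 exp_moment)
    (unit_bounded_restr mS).
- exact: (cintegrable_moment_fun mZ r0 gamma0 exp_moment)
    (unit_bounded_restr mS').
Qed.

Lemma ccvg_moment (S_ : nat -> set (R[i])^o) (S : set (R[i])^o) j k :
  (forall n, measurable (S_ n : set (borelC R))) ->
  (forall z, \forall n \near \oo, S_ n z <-> S z) ->
  ccvg (fun n => moment (S_ n) j k) (moment S j k).
Proof.
move=> mS hS.
have ig := cintegrable_normc (cintegrable_moment_fun mZ r0 gamma0 exp_moment
  'X^j 'X^k h_bounded).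
apply: (ccvg_cint _ _ ig _).2.
- by move=> n; apply: cmeasurable_moment_fun => //; case: (unit_bounded_restr (mS n)).
- move=> x; apply: ccvgM; first exact: ccvg_cst.
  apply: ccvgM; first exact: ccvg_cst.
  apply: ccvg_normc; apply: cvg_near_cst.
  have := hS (Z x); apply: filterS => n e; rewrite !indicE.
  by rewrite (_ : (Z x \in S_ n) = (Z x \in S)) ?subrr ?ComplexField.Normc.normc0//;
    apply/idP/idP; rewrite !inE => /e.
- by move=> n x; exact: moment_bound.
Qed.

(** Moments are countably additive, so the Borel sets whose trace on [W] is
    invisible form a Dynkin system; it contains the open sets. *)
Lemma slice_borel i A (W : set (R[i])^o) : open W ->
  (forall S : set (R[i])^o, open S -> S `<=` W -> slice i A (moment S) = 0) ->
  forall S : set (borelC R), measurable S -> S `<=` W -> slice i A (moment S) = 0.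
Proof.
move=> oW hW; have mW := open_measurable oW.
suff D : forall S : set (borelC R), measurable S ->
    slice i A (moment ((S : set (R[i])^o) `&` W)) = 0.
  by move=> S mS SW; have := D S mS; rewrite setIidl.
apply: (@dynkin_induction _ (borelC R) (@open (R[i])^o)) => //.
- exact: openI.
- by rewrite setTI; exact: hW.
- by move=> S oS; apply: hW; [exact: openI|exact: subIsetr].
- move=> S mS S0; have := hW W oW (@subset_refl _ W).
  have E : W = (S `&` W) `|` (~` S `&` W) by rewrite -setIUl setUv setTI.
  rewrite {1}E (_ : moment _ = fun j k => moment (S `&` W) j k +
      moment (~` S `&` W) j k) ?sliceD ?S0 ?add0r//.
  apply/funext => j; apply/funext => k; apply: momentU.
  + exact: measurableI.
  + by apply: measurableI => //; exact: measurableC.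
  + by rewrite setIACA setICr set0I.
- move=> F mF tF F0.
  pose U n := \bigcup_(k in `I_n) F k.
  have mU n : measurable (U n : set (borelC R)).
    by apply: bigcup_measurable => k _.
  have U0 n : slice i A (moment ((U n : set (R[i])^o) `&` W)) = 0.
    elim: n => [|n IH].
      have -> : U 0%N `&` W = set0.
        by rewrite /U II0 bigcup_set0 set0I.
      by apply: hW; [exact: open0|exact: sub0set].
    have -> : U n.+1 = U n `|` F n by rewrite /U IIS bigcup_setU bigcup_set1.
    rewrite setIUl (_ : moment _ = fun j k => moment (U n `&` W) j k +
      moment (F n `&` W) j k) ?sliceD ?IH ?F0 ?addr0//.
    apply/funext => j; apply/funext => k; apply: momentU.
    + exact: measurableI.
    + exact: measurableI.
    + rewrite setIACA (_ : U n `&` F n = set0) ?set0I//.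
      apply/seteqP; split => // z [[l /= ln Fl] Fn].
      have := tF l n I I; move=> e; move: ln; rewrite e ?ltnn//.
      by exists z.
  apply: (@ccvg_unique _ (fun=> 0) _ _ _ (ccvg_cst _)).
  rewrite -(_ : (fun n => slice i A (moment ((U n : set (R[i])^o) `&` W))) = fun=> 0);
    last exact/funext.
  apply: ccvg_slice => j k; apply: ccvg_moment.
    by move=> n; exact: measurableI.
  move=> z; have [[l _ Fl]|nF] := pselect ((\bigcup_k F k) z).
    exists l.+1 => // n /= ln; split => -[_ Wz]; split => //.
      by exists l.
    by exists l.
  by apply: nearW => n; split => -[[l _ Fl] _]; exfalso; apply: nF; exists l.
Qed.

(** The open sets are replaced by Borel sets one index at a time. *)
Lemma vandermonde_mass_borel O A : (forall i, open (O i)) ->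
  (forall i j z, O i z -> O j z -> i = j) ->
  (forall i, measurable (A i : set (borelC R))) -> (forall i, A i `<=` O i) ->
  vandermonde_mass A = 0.
Proof.
move=> oO dO.
suff H k : (k <= N)%N -> forall A, (forall i, measurable (A i : set (borelC R))) ->
    (forall i, A i `<=` O i) -> (forall i : 'I_N, (k <= i)%N -> open (A i)) ->
    vandermonde_mass A = 0.
  by move=> mA AO; apply: (H N) => // i; rewrite leqNgt ltn_ord.
elim: k => [_ {}A mA AO oA|k IH kN {}A mA AO oA].
  apply: vandermonde_mass_open => [i|i j z /AO Oi /AO Oj]; first exact: oA.
  exact: dO Oi Oj.
pose i := Ordinal kN.
have AE : A = update A i (A i).
  by apply/funext => l; rewrite /update; case: eqP => // ->.
rewrite AE vandermonde_mass_update; apply: (slice_borel (oO i)) => //.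
move=> S oS SO; rewrite -vandermonde_mass_update; apply: IH => [|l|l|l kl].
- exact: ltnW.
- by rewrite /update; case: eqP => // _; exact: open_measurable.
- by rewrite /update; case: eqP => // ->.
- rewrite /update; case: eqP => // /eqP li; apply: oA.
  by rewrite ltn_neqAle kl andbT; apply: contra li => /eqP kl'; apply/eqP/val_inj.
Qed.

End determinant_trick.

(** * Concentration at points *)

(** Being Lipschitz at a point is stable under products and conjugation. *)
Lemma monomial_lipschitz (R : realType) (zeta : R[i]) (j k : nat) :
  exists2 K : R, 0 <= K & forall z, normc (z - zeta) <= 1 ->
    normc (z ^+ j * (z ^+ k)^* - zeta ^+ j * (zeta ^+ k)^*) <=
    K * normc (z - zeta).
Proof.
pose lip (f : R[i] -> R[i]) := exists2 K : R, 0 <= K &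
  forall z, normc (z - zeta) <= 1 -> normc (f z - f zeta) <= K * normc (z - zeta).
have lipM f g : lip f -> lip g -> lip (fun z => f z * g z).
  move=> [K K0 hK] [L L0 hL].
  exists ((normc (f zeta) + K) * L + K * normc (g zeta)).
    by rewrite addr_ge0 ?mulr_ge0 ?addr_ge0 ?normc_ge0.
  move=> z z1.
  rewrite (_ : _ - _ = f z * (g z - g zeta) + (f z - f zeta) * g zeta); last by ring.
  apply: le_trans (le_normcD _ _) _; rewrite !ComplexField.Normc.normcM.
  rewrite mulrDl lerD//; last by rewrite mulrAC ler_wpM2r ?normc_ge0// hK.
  rewrite -mulrA ler_pM ?normc_ge0// ?hL//.
  rewrite (_ : f z = f zeta + (f z - f zeta)); last by ring.
  rewrite (le_trans (le_normcD _ _))// lerD2l (le_trans (hK _ z1))//.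
  by rewrite ler_piMr.
have lipX n : lip (fun z => z ^+ n).
  elim: n => [|n IH].
    by exists 0 => // z _; rewrite !expr0 subrr ComplexField.Normc.normc0 mul0r.
  under [X in lip X]eq_fun do rewrite exprS; apply: lipM => //.
  by exists 1 => // z _; rewrite mul1r.
apply: (lipM _ (fun z => (z ^+ k)^*) (lipX j)).
have [K K0 hK] := lipX k; exists K => // z z1.
by rewrite -rmorphB normc_conj; exact: hK.
Qed.

Section concentration.
Context d (X : measurableType d) (R : realType).
Variables (mu : {finite_measure set X -> \bar R}) (Z : X -> R[i]) (r : nat).
Variables (gamma : R) (N : nat).
Hypothesis mZ : cmeasurable Z.
Hypothesis mZB : measurable_fun setT (Z : X -> borelC R).
Hypothesis r0 : (0 < r)%N.
Hypothesis gamma0 : 0 < gamma.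
Hypothesis exp_moment :
  mu.-integrable setT (EFin \o (fun x => expR (gamma * normc (Z x) ^+ r))).
Variable h : X -> R[i].
Hypothesis h_bounded : unit_bounded h.
Hypothesis h_rank : rank_lt mu Z N h.
Hypothesis Nr : (N <= r)%N.

(** On [S n] the monomial differs from its value at [zeta] by [O(e n)], and the
    mass of the disc is at most a multiple of the modulus of the denominator. *)
Lemma ccvg_moment_quotient (zeta : R[i]) (e : nat -> R)
    (S : nat -> set (R[i])^o) j k :
  e @ \oo --> (0 : R) -> (forall n, e n <= 1) ->
  (forall n, measurable (S n : set (borelC R))) ->
  (forall n, S n `<=` disc zeta (e n)) ->
  (forall n, fine (mu (Z @^-1` disc zeta (e n))) <=
    4 * normc (cint mu (restr Z h (S n)))) ->
  (forall n, 0 < normc (cint mu (restr Z h (S n)))) ->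
  ccvg (fun n => moment mu Z h (S n) j k / cint mu (restr Z h (S n)))
    (zeta ^+ j * (zeta ^+ k)^*).
Proof.
move=> e0 e1 mS SD lower pos.
have [K K0 hK] := monomial_lipschitz zeta j k.
apply: ccvg_normc.
have lim : (fun n => 8 * K * e n) @ \oo --> (0 : R).
  by rewrite -[X in _ --> X](mulr0 (8 * K)); apply: cvgM => //; exact: cvg_cst.
apply: squeeze_cvgr (cvg_cst _) lim; apply: nearW => n; rewrite normc_ge0/=.
set c := cint mu _; have c0 : 0 < normc c := pos n.
have cn0 : c != 0.
  by apply: contraTneq c0 => ->; rewrite ComplexField.Normc.normc0 ltxx.
pose f z : R[i] := z ^+ j * (z ^+ k)^*.
have mD : measurable (Z @^-1` disc zeta (e n)).
  by apply: (restr_preimage mZB); apply: open_measurable; exact: open_disc.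
have br := unit_bounded_restr mZB h_bounded (mS n).
have ir : cintegrable mu (restr Z h (S n)).
  have := cintegrable_moment_fun mZ r0 gamma0 exp_moment 1 1 br.
  rewrite /moment_fun; under [X in cintegrable _ X]eq_fun do
    rewrite !hornerC rmorph1 !mul1r.
  by [].
have im : cintegrable mu (moment_fun Z (restr Z h (S n)) 'X^j 'X^k).
  exact: (cintegrable_moment_fun mZ r0 gamma0 exp_moment).
have dE : moment mu Z h (S n) j k - f zeta * c =
    cint mu (fun x => (f (Z x) - f zeta) * restr Z h (S n) x).
  rewrite -mulNr -cintZ// -cintD//; last exact: cintegrableZ.
  congr cint; apply/funext => x; rewrite /moment_fun !hornerXn /f; ring.
have -> : moment mu Z h (S n) j k / c - f zeta =
    (moment mu Z h (S n) j k - f zeta * c) / c.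
  by rewrite mulrBl mulfK.
rewrite ComplexField.Normc.normcM ComplexField.Normc.normcV.
rewrite ler_pdivrMr// dE.
pose g x : R := K * e n * \1_(Z @^-1` disc zeta (e n)) x.
have ig : mu.-integrable setT (EFin \o g).
  by apply: integrable_EFinZ; exact: integrable_indic.
have intg : \int[mu]_x g x = K * e n * fine (mu (Z @^-1` disc zeta (e n))).
  rewrite RintegralZl//; last exact: integrable_indic.
  by rewrite /Rintegral integral_indic// setIT.
apply: le_trans (normc_cint_le _ ig _) _.
- apply: cmeasurableM; last by case: br.
  apply: cmeasurableD; last exact: cmeasurable_cst.
  apply: cmeasurableM; first exact: cmeasurableX.
  by apply: cmeasurable_conj; exact: cmeasurableX.
- move=> x; rewrite /g; have [xS|xS] := pselect (S n (Z x)).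
    have zD := SD n _ xS.
    rewrite indicE mem_set// mulr1 ComplexField.Normc.normcM -[leRHS]mulr1.
    apply: ler_pM; rewrite ?normc_ge0//; last by case: br => _; exact.
    apply: le_trans (hK _ _) _; first exact: le_trans (ltW zD) (e1 n).
    by rewrite ler_wpM2l// ltW.
  rewrite /restr indicE memNset// !mulr0 ComplexField.Normc.normc0.
  have [en0|en0] := leP 0 (e n); first by rewrite !mulr_ge0.
  rewrite indicE memNset ?mulr0// /disc/= => lt0.
  by have := lt_trans lt0 en0; rewrite ltNge normc_ge0.
- rewrite intg.
  have [en0|en0] := leP 0 (e n).
    have := lower n; rewrite -/c => lo.
    have : K * e n * fine (mu (Z @^-1` disc zeta (e n))) <=
        K * e n * (4 * normc c) by rewrite ler_wpM2l// mulr_ge0.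
    lra.
  exfalso; have := lower n.
  have D0 : disc zeta (e n) = set0.
    apply/seteqP; split => // w; rewrite /disc/= => lt0.
    by have := lt_trans lt0 en0; rewrite ltNge normc_ge0.
  have S0 : S n = set0 by apply/seteqP; split => // w /SD; rewrite D0.
  move: c0; rewrite /c S0 (_ : restr Z h set0 = fun=> 0) ?cint0.
    by rewrite ComplexField.Normc.normc0 ltxx.
  by apply/funext => x; rewrite /restr indic0 mulr0.
Qed.

(** Sets [S i n] shrinking to [zeta i] make the normalized moments converge to
    monomials at [zeta i], so the vanishing [vandermonde_mass] becomes
    [|vandermonde zeta|^2 = 0]. *)
Lemma few_support_points :
  (forall U : set (R[i])^o, open U -> (0 < mu (Z @^-1` U))%E ->
    exists S : set (R[i])^o, [/\ measurable (S : set (borelC R)), S `<=` U &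
      fine (mu (Z @^-1` U)) <= 4 * normc (cint mu (restr Z h S))]) ->
  forall zeta : 'I_N -> R[i], injective zeta ->
  ~ forall i e, 0 < e -> (0 < mu (Z @^-1` disc (zeta i) e))%E.
Proof.
move=> lower zeta inj_z supp.
(* From the radius [1 / (n0 + 1)] on, the discs around the points are
   disjoint. *)
have [n0 n0P] : exists n0, forall i j : 'I_N, i != j ->
    2 * n0.+1%:R^-1 <= normc (zeta i - zeta j).
  have : \forall n \near \oo, forall i j : 'I_N, i != j ->
      2 * n.+1%:R^-1 <= normc (zeta i - zeta j).
    apply: filter_forall => i; apply: filter_forall => j.
    have [->|ij] := eqVneq i j; first by apply: nearW => n /eqP.
    have p0 : 0 < normc (zeta i - zeta j) / 2.
      rewrite divr_gt0// lt_def normc_ge0 andbT.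
      apply: contra_neq ij => /ComplexField.Normc.eq0_normc/eqP.
      by rewrite subr_eq0 => /eqP/inj_z.
    have [m _ hm] := (cvgr0Pnorm_le _).1 (@cvg_harmonic R) _ p0.
    exists m => // n /= mn _; have := hm n mn; rewrite /= ger0_norm// => le.
    by rewrite mulrC -ler_pdivlMr.
  by move=> [m _ /(_ m (leqnn _))]; exists m.
pose e n : R := (n + n0).+1%:R^-1.
have e_gt0 n : 0 < e n by rewrite invr_gt0.
have e_le n : e n <= n0.+1%:R^-1.
  by rewrite lef_pV2 ?posrE// ler_nat ltnS leq_addl.
have e_le1 n : e n <= 1 by rewrite invf_le1 ?ler1n.
have e0 : e @ \oo --> (0 : R).
  apply: squeeze_cvgr (cvg_cst 0) (@cvg_harmonic R); apply: nearW => n.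
  by rewrite ltW//= lef_pV2 ?posrE// ler_nat ltnS leq_addr.
have od i n : open (disc (zeta i) (e n)) by exact: open_disc.
pose S i n := sval (cid (lower _ (od i n) (supp i _ (e_gt0 n)))).
have SP i n : [/\ measurable (S i n : set (borelC R)),
    S i n `<=` disc (zeta i) (e n) &
    fine (mu (Z @^-1` disc (zeta i) (e n))) <=
      4 * normc (cint mu (restr Z h (S i n)))].
  by rewrite /S; case: cid.
have mS i n : measurable (S i n : set (borelC R)) by case: (SP i n).
have SD i n : S i n `<=` disc (zeta i) (e n) by case: (SP i n).
have low i n : fine (mu (Z @^-1` disc (zeta i) (e n))) <=
    4 * normc (cint mu (restr Z h (S i n))) by case: (SP i n).
have pos i n : 0 < normc (cint mu (restr Z h (S i n))).
  have mu0 : 0 < fine (mu (Z @^-1` disc (zeta i) (e n))).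
    rewrite fine_gt0// supp//= -ge0_fin_numE// fin_num_measure//.
    by apply: (restr_preimage mZB); exact: open_measurable.
  by have := low i n; lra.
have mass0 n : vandermonde_mass mu Z h (fun i => S i n) = 0.
  apply: (vandermonde_mass_borel mZ mZB r0 gamma0 exp_moment h_bounded h_rank Nr
    (O := fun i => disc (zeta i) (e n))) => // i j z zi zj.
  apply: contrapT => /eqP ij; have := n0P _ _ ij.
  rewrite leNgt => /negP; apply.
  have -> : zeta i - zeta j = - (z - zeta i) + (z - zeta j) by ring.
  apply: le_lt_trans (le_normcD _ _) _; rewrite normcN mulr_natl mulr2n.
  by rewrite ltrD// (lt_le_trans _ (e_le n)).
have quotient n : \sum_(s : {perm 'I_N}) \sum_(t : {perm 'I_N})
    (-1) ^+ s * (-1) ^+ t *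
    \prod_i (moment mu Z h (S i n) (s i) (t i) / cint mu (restr Z h (S i n))) = 0.
  rewrite -[RHS](mul0r (\prod_i cint mu (restr Z h (S i n)))^-1).
  rewrite -[in RHS](mass0 n).
  rewrite mulr_suml; apply: eq_bigr => s _.
  rewrite mulr_suml; apply: eq_bigr => t _.
  by rewrite big_split/= prodfV mulrA.
have : vandermonde zeta * (vandermonde zeta)^* = 0.
  apply/esym/(@ccvg_unique _ (fun=> 0)); first exact: ccvg_cst.
  rewrite -(_ : (fun n => \sum_(s : {perm 'I_N}) \sum_(t : {perm 'I_N})
    (-1) ^+ s * (-1) ^+ t * \prod_i (moment mu Z h (S i n) (s i) (t i) /
    cint mu (restr Z h (S i n)))) = fun=> 0); last exact/funext.
  rewrite vandermonde_sqr; apply: ccvg_sum => s; apply: ccvg_sum => t.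
  apply: ccvgM; first exact: ccvg_cst.
  by apply: ccvg_prod => i; apply: (ccvg_moment_quotient _ _ e0).
move/eqP; rewrite mulf_eq0 conjc_eq0 orbb.
by rewrite (negbTE (vandermonde_neq0 inj_z)).
Qed.

End concentration.

(** * Signed measures on a doubled space *)

Section two_copies.
Context d (Y : measurableType d) (R : realType).

Definition copy_measure (b : bool) (m : {measure set Y -> \bar R}) :
    {measure set (Y * bool) -> \bar R} :=
  measure_function_pushforward__canonical__measure_function_Measure m
    (pair2_measurable b).

Variables m1 m2 : {finite_measure set Y -> \bar R}.

(** A signed measure with Jordan parts [m1] and [m2] becomes this positive
    measure with density [1] on one copy and [-1] on the other, so that no
    Radon-Nikodym density has to be chosen. *)
Definition two_copies : set (Y * bool) -> \bar R :=
  measure_add (copy_measure true m1) (copy_measure false m2).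

HB.instance Definition _ := Measure.on two_copies.

Lemma two_copiesE (A : set (Y * bool)) : two_copies A =
  (m1 [set y | A (y, true)] + m2 [set y | A (y, false)])%E.
Proof. exact: measure_addE. Qed.

Let measurable_slice b (A : set (Y * bool)) :
  measurable A -> measurable [set y | A (y, b)].
Proof.
move=> mA; rewrite -[X in measurable X]setTI.
exact: (pair2_measurable b measurableT mA).
Qed.

Let two_copies_fin : fin_num_fun two_copies.
Proof.
move=> A mA; rewrite two_copiesE fin_numD.
by rewrite !fin_num_measure//; exact: measurable_slice.
Qed.

HB.instance Definition _ := Measure_isFinite.Build _ _ _
  two_copies two_copies_fin.

Lemma integral_two_copies (f : Y * bool -> \bar R) :
  (forall z, 0 <= f z)%E -> measurable_fun setT f ->
  (\int[two_copies]_z f z =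
   \int[m1]_y f (y, true) + \int[m2]_y f (y, false))%E.
Proof.
move=> f0 mf; rewrite ge0_integral_measure_add//; congr (_ + _)%E.
  by rewrite (ge0_integral_pushforward (pair2_measurable true))// preimage_setT.
by rewrite (ge0_integral_pushforward (pair2_measurable false))// preimage_setT.
Qed.

Lemma Rintegral_two_copies (f : Y * bool -> R) : measurable_fun setT f ->
  m1.-integrable setT (EFin \o (fun y => f (y, true))) ->
  m2.-integrable setT (EFin \o (fun y => f (y, false))) ->
  two_copies.-integrable setT (EFin \o f) /\
  \int[two_copies]_z f z = \int[m1]_y f (y, true) + \int[m2]_y f (y, false).
Proof.
move=> mf i1 i2; have mEf : measurable_fun setT (EFin \o f).
  exact/measurable_EFinP.
have I : two_copies.-integrable setT (EFin \o f).
  apply/integrableP; split => //.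
  rewrite (@integral_two_copies (fun z => `|(EFin \o f) z|)%E)//; last first.
    exact: measurableT_comp.
  have /integrableP[_ l1] := i1; have /integrableP[_ l2] := i2.
  exact: lte_add_pinfty.
split=> //; rewrite /Rintegral -fineD; [|exact: integrable_fin_num..].
have P1 : (copy_measure true m1).-integrable setT (EFin \o f).
  by apply: (integrable_pushforward (pair2_measurable true)); rewrite ?preimage_setT.
have P2 : (copy_measure false m2).-integrable setT (EFin \o f).
  by apply: (integrable_pushforward (pair2_measurable false)); rewrite ?preimage_setT.
congr fine; rewrite integral_measure_add//; congr (_ + _)%E.
  by rewrite (integral_pushforward (pair2_measurable true))// preimage_setT.
by rewrite (integral_pushforward (pair2_measurable false))// preimage_setT.
Qed.

Lemma cint_two_copies (f : Y * bool -> R[i]) : cmeasurable f ->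
  cintegrable m1 (fun y => f (y, true)) ->
  cintegrable m2 (fun y => f (y, false)) ->
  cintegrable two_copies f /\
  cint two_copies f =
    cint m1 (fun y => f (y, true)) + cint m2 (fun y => f (y, false)).
Proof.
move=> [mr mi] [r1 i1] [r2 i2].
have [ir er] := Rintegral_two_copies mr r1 r2.
have [ii ei] := Rintegral_two_copies mi i1 i2.
by split=> //; rewrite /cint er ei.
Qed.

End two_copies.

(** * Complex measures and Toeplitz forms *)

Section borel_plane.
Context {R : realType}.

Lemma measurable_Re_Im :
  measurable_fun setT (fun z : borelC R => Re z) /\
  measurable_fun setT (fun z : borelC R => Im z).
Proof.
have aux (f : R[i] -> R) : (forall z w, `|f z - f w| <= normc (z - w)) ->
    measurable_fun setT (f : borelC R -> R).
  move=> lip; apply: (measurability _ (RGenOpens.measurableE R)).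
  move=> _ [_ [a [b ->]] <-]; rewrite setTI; apply: open_measurable.
  rewrite openE => z /=; rewrite in_itv/= => /andP[az zb].
  have e0 : 0 < Num.min (f z - a) (b - f z) by rewrite lt_min !subr_gt0 az.
  apply: (@filterS _ (nbhs (z : (R[i])^o)) _
    ([set w | normc (w - z) < Num.min (f z - a) (b - f z)] : set (R[i])^o)).
    move=> w /= wz; have := le_lt_trans (lip w z) wz.
    rewrite lt_min !ltr_norml in_itv/= => /andP[/andP[h1 h2] /andP[h3 h4]].
    by apply/andP; split; lra.
  apply: open_nbhs_nbhs; split; first exact: open_disc.
  by rewrite /= subrr ComplexField.Normc.normc0.
split; apply: aux => z w.
  by rewrite -ReN -ReD; exact: normc_Re.
by rewrite -ImN -ImD; exact: normc_Im.
Qed.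

End borel_plane.

Section complex_measure.
Context {R : realType} (nu : complex_measure R).

Definition pos_Re : {finite_measure set (borelC R) -> \bar R} :=
  jordan_pos (hahn_choice (cm_Re nu)).
Definition neg_Re : {finite_measure set (borelC R) -> \bar R} :=
  jordan_neg (hahn_choice (cm_Re nu)).
Definition pos_Im : {finite_measure set (borelC R) -> \bar R} :=
  jordan_pos (hahn_choice (cm_Im nu)).
Definition neg_Im : {finite_measure set (borelC R) -> \bar R} :=
  jordan_neg (hahn_choice (cm_Im nu)).

(** Four copies of the plane, carrying the positive and negative parts of the
    real and imaginary parts of [nu]: on this space the density of [nu] is the
    function [unit_density], constant of modulus one on each copy. *)
Definition quadruple :
    {finite_measure set (borelC R * bool * bool)%type -> \bar R} :=
  two_copies (two_copies pos_Re neg_Re) (two_copies pos_Im neg_Im).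

Definition base (x : (borelC R * bool * bool)%type) : R[i] := x.1.1.

Definition unit_density (x : (borelC R * bool * bool)%type) : R[i] :=
  (if x.2 then 1 else 'i%C) * (if x.1.2 then 1 else -1).

Lemma measurable_base : measurable_fun setT (base : _ -> borelC R).
Proof. exact: measurableT_comp measurable_fst measurable_fst. Qed.

Lemma cmeasurable_borel (f : borelC R -> R[i]) :
  cmeasurable f -> cmeasurable (fun x => f (base x)).
Proof.
by move=> [a b]; split; [exact: (measurableT_comp a measurable_base)
  |exact: (measurableT_comp b measurable_base)].
Qed.

Lemma cmeasurable_base : cmeasurable base.
Proof. by apply: (@cmeasurable_borel id); have [] := @measurable_Re_Im R. Qed.

Lemma unit_bounded_density : unit_bounded unit_density.
Proof.
split.
  apply: cmeasurableM; split.
  - rewrite (_ : (fun x => _) = fun x => if x.2 then 1 else 0).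
      by apply: measurable_fun_ifT => //; exact: measurable_snd.
    by apply/funext => -[? []].
  - rewrite (_ : (fun x => _) = fun x => if x.2 then 0 else 1).
      by apply: measurable_fun_ifT => //; exact: measurable_snd.
    by apply/funext => -[? []].
  - rewrite (_ : (fun x => _) = fun x => if x.1.2 then 1 else -1).
      apply: measurable_fun_ifT => //.
      exact: measurableT_comp measurable_snd measurable_fst.
    by apply/funext => -[[? []] ?].
  - rewrite (_ : (fun x => _) = fun x => 0) ?oppr0; first exact: measurable_cst.
    by apply/funext => -[[? []] ?] /=; rewrite ?oppr0.
have i1 : normc ('i%C : R[i]) = 1 by rewrite /= expr0n add0r expr1n sqrtr1.
move=> x; rewrite ComplexField.Normc.normcM; case: x.2; case: x.1.2;
  by rewrite ?normcN ?ComplexField.Normc.normc1 ?i1 ?mulr1.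
Qed.

Let charge_integral_Re (g : borelC R -> R) : charge_integral (cm_Re nu) g =
  \int[pos_Re]_z g z - \int[neg_Re]_z g z.
Proof. reflexivity. Qed.

Let charge_integral_Im (g : borelC R -> R) : charge_integral (cm_Im nu) g =
  \int[pos_Im]_z g z - \int[neg_Im]_z g z.
Proof. by []. Qed.

Let four_parts (a b c e : R[i]) :
  1 * 1 * a + 1 * -1 * b + ('i%C * 1 * c + 'i%C * -1 * e) =
  (Re a - Re b - (Im c - Im e)) +i* (Re c - Re e + (Im a - Im b)).
Proof.
by apply: complex_eq; rewrite !(ReD, ImD, ReM, ImM, ReN, ImN)/=; ring.
Qed.

Lemma cint_quadruple (f : borelC R -> R[i]) :
  cintegrable pos_Re f -> cintegrable neg_Re f ->
  cintegrable pos_Im f -> cintegrable neg_Im f ->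
  cint quadruple (fun x => f (base x) * unit_density x) = cm_integral nu f.
Proof.
move=> i1 i2 i3 i4.
have mF : cmeasurable (fun x => f (base x) * unit_density x).
  apply: cmeasurableM; last by case: unit_bounded_density.
  by apply: cmeasurable_borel; exact: cintegrable_cmeasurable i1.
have slice (b : bool) :
    cmeasurable (fun y => f (base (y, b)) * unit_density (y, b)).
  by case: mF => a c; split;
    [exact: (measurableT_comp a (pair2_measurable b))
    |exact: (measurableT_comp c (pair2_measurable b))].
have Zr (m : {measure set (borelC R) -> \bar R}) c : cintegrable m f ->
    cintegrable m (fun z => f z * c) /\ cint m (fun z => f z * c) = c * cint m f.
  move=> im; have -> : (fun z => f z * c) = fun z => c * f z.
    by apply/funext => z; rewrite mulrC.
  by split; [exact: cintegrableZ|exact: cintZ].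
have [j1 e1] := Zr _ (1 * 1) i1; have [j2 e2] := Zr _ (1 * -1) i2.
have [j3 e3] := Zr _ ('i%C * 1) i3; have [j4 e4] := Zr _ ('i%C * -1) i4.
have [jR eR] := cint_two_copies (slice true) j1 j2.
have [jI eI] := cint_two_copies (slice false) j3 j4.
have [_ ->] := cint_two_copies mF jR jI.
rewrite eR eI /= e1 e2 e3 e4 four_parts /cm_integral.
by rewrite !charge_integral_Re !charge_integral_Im /cint.
Qed.

Lemma quadrupleE (S : set (R[i])^o) :
  quadruple (base @^-1` S) = (pos_Re S + neg_Re S + (pos_Im S + neg_Im S))%E.
Proof. 
exact: etrans (two_copiesE _ _ _)
  (f_equal2 adde (two_copiesE _ _ _) (two_copiesE _ _ _)). Qed.

Lemma cint_restr (S : set (borelC R)) : measurable S ->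
  cint quadruple (restr base unit_density S) = nu S.
Proof.
move=> mS.
have ic (m : {finite_measure set (borelC R) -> \bar R}) :
    cintegrable m (fun z => (\1_S z)%:C).
  split; first exact: integrable_indic.
  exact: integrable0.
have -> : restr base unit_density S =
    fun x => (\1_S (base x))%:C * unit_density x.
  by apply/funext => x; rewrite /restr mulrC.
rewrite (cint_quadruple (ic _) (ic _) (ic _) (ic _)).
have I1 (m : {finite_measure set (borelC R) -> \bar R}) :
    \int[m]_z \1_S z = fine (m S).
  by rewrite /Rintegral integral_indic// setIT.
have I0 (m : {finite_measure set (borelC R) -> \bar R}) :
    \int[m]_z (0 : R) = 0.
  by rewrite /Rintegral integral0.
have jd (k : {charge set (borelC R) -> \bar R}) : fine (k S) =
    fine (jordan_pos (hahn_choice k) S) - fine (jordan_neg (hahn_choice k) S).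
  rewrite {1}(jordan_decomp (hahn_choice k) mS) /cadd /= cscaleN1 fineD//.
  - by rewrite fineN.
  - exact: fin_num_measure.
  - by rewrite fin_numN; exact: fin_num_measure.
rewrite /cm_integral !charge_integral_Re !charge_integral_Im /=.
rewrite !I1 !I0 !subrr subr0 addr0.
rewrite /cm_fun.
have -> : fine (cm_Re nu S) = fine (pos_Re S) - fine (neg_Re S) := jd _.
have -> : fine (cm_Im nu S) = fine (pos_Im S) - fine (neg_Im S) := jd _.
by [].
Qed.

(** One of the four parts of [nu] carries at least a quarter of the mass of
    [U], and up to sign it is the restriction of [Re nu] or [Im nu] to a Hahn
    set. *)
Lemma quarter_mass (U : set (R[i])^o) : open U ->
  exists S : set (R[i])^o, [/\ measurable (S : set (borelC R)), S `<=` U &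
    fine (quadruple (base @^-1` U)) <=
      4 * normc (cint quadruple (restr base unit_density S))].
Proof.
move=> oU; have mU := open_measurable oU.
have jpos (k : {charge set (borelC R) -> \bar R}) : exists S : set (R[i])^o,
    [/\ measurable (S : set (borelC R)), S `<=` U &
    jordan_pos (hahn_choice k) U = k S].
  have [[mP _] _ _ _] := hahn_choice k.
  exists (U `&` (sval (cid (hahn_ex k))).1); split.
  - exact: measurableI.
  - exact: subIsetl.
  - by rewrite jordan_posE cjordan_posE /crestr0 mem_set.
have jneg (k : {charge set (borelC R) -> \bar R}) : exists S : set (R[i])^o,
    [/\ measurable (S : set (borelC R)), S `<=` U &
    jordan_neg (hahn_choice k) U = (- k S)%E].
  have [_ [mN _] _ _] := hahn_choice k.
  exists (U `&` (sval (cid (hahn_ex k))).2); split.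
  - exact: measurableI.
  - exact: subIsetl.
  - by rewrite jordan_negE cjordan_negE /crestr0 mem_set.
have fin (m : {finite_measure set (borelC R) -> \bar R}) : m U \is a fin_num.
  exact: fin_num_measure.
pose a := fine (pos_Re U); pose b := fine (neg_Re U).
pose c := fine (pos_Im U); pose e := fine (neg_Im U).
have total : fine (quadruple (base @^-1` U)) = a + b + (c + e).
  by rewrite quadrupleE !fineD// fin_numD !fin.
have ge0 (m : {finite_measure set (borelC R) -> \bar R}) : 0 <= fine (m U).
  by rewrite fine_ge0.
have [a0 b0 c0 e0] : [/\ 0 <= a, 0 <= b, 0 <= c & 0 <= e] by split; exact: ge0.
have quarter x S : measurable (S : set (borelC R)) ->
    x <= normc (cint quadruple (restr base unit_density S)) ->
    a + b + (c + e) <= 4 * x ->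
    fine (quadruple (base @^-1` U)) <=
      4 * normc (cint quadruple (restr base unit_density S)).
  by rewrite total => _; lra.
have byRe S x : measurable (S : set (borelC R)) ->
    x = fine (cm_Re nu S) \/ x = - fine (cm_Re nu S) ->
    x <= normc (cint quadruple (restr base unit_density S)).
  move=> mS hx; rewrite cint_restr//; apply: le_trans (normc_Re _).
  by case: hx => -> /=; [exact: ler_norm|rewrite -normrN ler_norm].
have byIm S x : measurable (S : set (borelC R)) ->
    x = fine (cm_Im nu S) \/ x = - fine (cm_Im nu S) ->
    x <= normc (cint quadruple (restr base unit_density S)).
  move=> mS hx; rewrite cint_restr//; apply: le_trans (normc_Im _).
  by case: hx => -> /=; [exact: ler_norm|rewrite -normrN ler_norm].
have : [\/ a + b + (c + e) <= 4 * a, a + b + (c + e) <= 4 * b,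
    a + b + (c + e) <= 4 * c | a + b + (c + e) <= 4 * e].
  have [h1|h1] := leP (a + b + (c + e)) (4 * a); first by constructor 1.
  have [h2|h2] := leP (a + b + (c + e)) (4 * b); first by constructor 2.
  have [h3|h3] := leP (a + b + (c + e)) (4 * c); first by constructor 3.
  by constructor 4; lra.
case=> hq.
- have [S [mS SU E]] := jpos (cm_Re nu); exists S; split => //.
  by apply: quarter hq => //; apply: byRe => //; left; exact: (congr1 fine E).
- have [S [mS SU E]] := jneg (cm_Re nu); exists S; split => //.
  by apply: quarter hq => //; apply: byRe => //; right; rewrite -fineN; exact: (congr1 fine E).
- have [S [mS SU E]] := jpos (cm_Im nu); exists S; split => //.
  by apply: quarter hq => //; apply: byIm => //; left; exact: (congr1 fine E).
- have [S [mS SU E]] := jneg (cm_Im nu); exists S; split => //.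
  by apply: quarter hq => //; apply: byIm => //; right; rewrite -fineN; exact: (congr1 fine E).
Qed.

Section exponential_moment.
Variables (r : nat) (gamma : R).
Hypothesis r0 : (0 < r)%N.
Hypothesis gamma0 : 0 < gamma.
Hypothesis exp_lty : (\int[cm_variation nu]_z
  (expR (gamma * ComplexField.Normc.normc z ^+ r))%:E < +oo)%E.

Let weight (z : borelC R) : R := expR (gamma * normc z ^+ r).

Let measurable_weight : measurable_fun setT weight.
Proof.
apply: measurableT_comp; first exact: measurable_expR.
apply: measurable_funM; first exact: measurable_cst.
apply: measurable_funX; apply: measurable_normc.
by have [a b] := @measurable_Re_Im R.
Qed.

Let integral_weight :
  (\int[pos_Re]_z (weight z)%:E + \int[neg_Re]_z (weight z)%:E +
  (\int[pos_Im]_z (weight z)%:E + \int[neg_Im]_z (weight z)%:E) < +oo)%E.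
Proof.
have mW : measurable_fun setT (EFin \o weight) by exact/measurable_EFinP.
have W0 z : (0 <= (weight z)%:E)%E by rewrite lee_fin expR_ge0.
have varE (k : {charge set (borelC R) -> \bar R}) :
    (\int[signed_variation k]_z (weight z)%:E =
    \int[jordan_pos (hahn_choice k)]_z (weight z)%:E +
    \int[jordan_neg (hahn_choice k)]_z (weight z)%:E)%E.
  rewrite -ge0_integral_measure_add//; apply: eq_measure_integral => A mA _.
  exact/esym/measure_addE.
have := exp_lty; rewrite /cm_variation ge0_integral_measure_add//.
by rewrite !varE.
Qed.

Lemma exponential_moment_quadruple : quadruple.-integrable setT
  (EFin \o (fun x => expR (gamma * normc (base x) ^+ r))).
Proof.
have mX : measurable_fun setT (fun x => weight (base x)).
  exact: (measurableT_comp measurable_weight measurable_base).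
apply/integrableP; split; first exact/measurable_EFinP.
rewrite /=; under eq_integral do rewrite ger0_norm ?expR_ge0//.
have mE : measurable_fun setT (fun x => (weight (base x))%:E).
  exact/measurable_EFinP.
rewrite integral_two_copies//.
rewrite integral_two_copies//; last exact: (measurableT_comp mE (pair2_measurable _)).
rewrite integral_two_copies//; last exact: (measurableT_comp mE (pair2_measurable _)).
Qed.

Lemma toeplitz_moment (u v : {poly R[i]}) :
  cint quadruple (moment_fun base unit_density u v) = toeplitz nu u v.
Proof.
have w0 (m : {finite_measure set (borelC R) -> \bar R}) :
    (0 <= \int[m]_z (weight z)%:E)%E.
  by apply: integral_ge0 => z _; rewrite lee_fin expR_ge0.
have im (m : {finite_measure set (borelC R) -> \bar R}) :
    (\int[m]_z (weight z)%:E < +oo)%E ->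
    cintegrable m (fun z : borelC R => u.[z] * (v.[z])^*).
  move=> lm; have ew : m.-integrable setT (EFin \o weight).
    apply/integrableP; split; first exact/measurable_EFinP.
    by under eq_integral do rewrite /= ger0_norm ?expR_ge0//.
  have one : unit_bounded (fun=> 1 : R[i]) (X := borelC R).
    split; first exact: cmeasurable_cst.
    by move=> z; rewrite ComplexField.Normc.normc1.
  have := cintegrable_moment_fun (mu := m) (Z := id) (@measurable_Re_Im R)
    r0 gamma0 ew u v one.
  by rewrite /moment_fun; under [X in cintegrable _ X]eq_fun do rewrite mulr1.
have fin_le (x y : \bar R) : (0 <= y -> x + y < +oo -> x < +oo)%E.
  by move=> y0; apply: le_lt_trans; rewrite leeDl.
have tot := integral_weight.
have lR := fin_le _ _ (adde_ge0 (w0 _) (w0 _)) tot.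
have lI := fin_le _ _ (adde_ge0 (w0 _) (w0 _)) (etrans (congr1 (fun x => x < +oo)%E
  (addeC _ _)) tot).
apply: cint_quadruple; apply: im.
- exact: fin_le (w0 _) lR.
- by apply: fin_le (w0 pos_Re) _; rewrite addeC.
- exact: fin_le (w0 _) lI.
- by apply: fin_le (w0 pos_Im) _; rewrite addeC.
Qed.

(** A form of rank [n] has Gram matrices that factor through dimension [n]. *)
Lemma toeplitz_rank_lt n :
  toeplitz_rank nu n -> rank_lt quadruple base n.+1 unit_density.
Proof.
move=> [e [_ _ spane]] u v.
have cf j : exists a : 'I_n -> R[i],
    toeplitz nu (u j) = \sum_i a i *: (e i : {poly R[i]} -> (R[i])^o).
  by apply: spane; exists (u j).
pose A : 'M[R[i]]_(n.+1, n) := \matrix_(j, i) sval (cid (cf j)) i.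
pose B : 'M[R[i]]_(n, n.+1) := \matrix_(i, k) e i (v k).
rewrite (_ : \matrix_(j, k) _ = A *m B); last first.
  apply/matrixP => j k; rewrite !mxE toeplitz_moment.
  under eq_bigr do rewrite !mxE.
  case: cid => a /= ->; rewrite fct_sumE; exact: eq_bigr.
apply/eqP; apply: contraT => d0.
have : A *m B \in unitmx by rewrite unitmxE unitfE.
move=> /mxrank_unit rAB; have := leq_trans (mxrankM_maxl A B) (rank_leq_col A).
by rewrite rAB ltnn.
Qed.

End exponential_moment.

Definition support_point (z : R[i]) :=
  forall e : R, 0 < e -> (0 < quadruple (base @^-1` disc z e))%E.

(** The complement of the support is covered by countably many null discs. *)
Lemma null_off_support : exists D : set (borelC R),
  [/\ measurable D, quadruple (base @^-1` (D : set (R[i])^o)) = 0%E &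
    forall z, ~ support_point z -> D z].
Proof.
pose x (ab : rat * rat) : R[i] := ratr ab.1 +i* ratr ab.2.
pose rdisc (u : nat * (rat * rat)) := disc (x u.2) u.1.+1%:R^-1.
pose F n : set (R[i])^o := if @unpickle (nat * (rat * rat))%type n is Some u then
  if quadruple (base @^-1` rdisc u) == 0%E then rdisc u else set0 else set0.
have oF n : open (F n).
  rewrite /F; case: unpickle => [u|]; last exact: open0.
  by case: ifP => _; [exact: open_disc|exact: open0].
have F0 n : quadruple (base @^-1` F n) = 0%E.
  rewrite /F; case: unpickle => [u|]; last by rewrite preimage_set0 measure0.
  by case: ifP => [/eqP|_] //; rewrite preimage_set0 measure0.
have mF n : measurable (base @^-1` F n).
  by apply: (restr_preimage measurable_base); exact: open_measurable.
exists (\bigcup_n F n); split.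
- by apply: bigcupT_measurable => n; exact: open_measurable.
- apply/eqP; rewrite eq_le measure_ge0 andbT preimage_bigcup.
  have mU : measurable (\bigcup_n (base @^-1` F n)) by exact: bigcupT_measurable.
  have := measure_sigma_subadditive quadruple mF mU (@subset_refl _ _).
  by rewrite eseries0// => n _ _; exact: F0.
- move=> z nsz.
  have [e [e0 null]] : exists e : R, 0 < e /\
      quadruple (base @^-1` disc z e) = 0%E.
    apply: contrapT => h; apply: nsz => e e0; rewrite lt_def measure_ge0 andbT.
    by apply/negP => /eqP q0; apply: h; exists e.
  have e20 : 0 < e / 2 by rewrite divr_gt0.
  have [L _ /(_ L (leqnn _))] := (cvgr0Pnorm_lt _).1 (@cvg_harmonic R) _ e20.
  rewrite /= ger0_norm// => hL.
  have L0 : 0 < L.+1%:R^-1 :> R by rewrite invr_gt0.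
  have [ab hab] := dense_rat_complex z L0.
  exists (pickle (L, ab)) => //; rewrite /F pickleK.
  rewrite (_ : quadruple (base @^-1` rdisc (L, ab)) == 0%E); first exact: hab.
  rewrite eq_le measure_ge0 andbT -null.
  apply: le_measure; rewrite ?inE.
  + by apply: (restr_preimage measurable_base); apply: open_measurable; exact: open_disc.
  + by apply: (restr_preimage measurable_base); apply: open_measurable; exact: open_disc.
  + move=> y yx; have {}yx : normc (base y - x ab) < L.+1%:R^-1 by exact: yx.
    suff : normc (base y - z) < e by [].
    have -> : base y - z = (base y - x ab) + - (z - x ab) by ring.
    apply: le_lt_trans (le_normcD _ _) _; rewrite normcN [ltRHS]splitr.
    by rewrite ltrD// (lt_trans _ hL).
Qed.

Lemma measurable_point (z : R[i]) : measurable ([set z] : set (borelC R)).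
Proof.
rewrite (_ : [set z] = \bigcap_n
    (disc z n.+1%:R^-1 : set (borelC R))).
  by apply: bigcapT_measurable => n; apply: open_measurable; exact: open_disc.
apply/seteqP; split => w /=.
  by move=> -> n _; rewrite /disc/= subrr ComplexField.Normc.normc0 invr_gt0.
move=> h; apply/eqP; rewrite -subr_eq0; apply/eqP/ComplexField.Normc.eq0_normc.
apply/eqP; rewrite eq_le normc_ge0 andbT leNgt; apply/negP => p0.
have [L _ /(_ L (leqnn _))] := (cvgr0Pnorm_lt _).1 (@cvg_harmonic R) _ p0.
rewrite /= ger0_norm// => hL; have := lt_trans (h L I) hL.
by rewrite ltxx.
Qed.

(** Off the points, [nu] is dominated by the null part of [quadruple]; on them
    its density is a finite sum of point indicators. *)
Lemma sum_of_atoms (s : seq R[i]) : uniq s -> (forall z, support_point z -> z \in s) ->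
  forall E : set (borelC R), measurable E ->
    nu E = \sum_(z <- s) nu [set z] * (fine (\d_(z : borelC R) E))%:C.
Proof.
move=> us supp_s E mE.
have [D [mD D0 suppD]] := null_off_support.
pose E' : set (borelC R) := E `\` [set` s].
have ms : measurable ([set` s] : set (borelC R)).
  rewrite (_ : [set` s] = \bigcup_(z in [set` s]) [set z]); last first.
    by apply/seteqP; split => [w ws|w [z zs ->] //]; exists w.
  by apply: fin_bigcup_measurable => [|z _]; [exact: finite_seq|exact: measurable_point].
have mE' : measurable E' by exact: measurableD.
have E'0 : nu E' = 0.
  rewrite -cint_restr//; apply: ComplexField.Normc.eq0_normc; apply/eqP.
  rewrite eq_le normc_ge0 andbT.
  have mE'b := restr_preimage measurable_base mE'.
  have ig : quadruple.-integrable setT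
      (EFin \o (fun x => \1_(base @^-1` (E' : set (R[i])^o)) x : R)).
    exact: integrable_indic.
  have [mr _] := unit_bounded_restr measurable_base unit_bounded_density mE'.
  apply: le_trans (normc_cint_le mr ig _) _.
    move=> x; rewrite /restr ComplexField.Normc.normcM normc_real.
    have [_ h1] := unit_bounded_density.
    have -> : \1_(base @^-1` (E' : set (R[i])^o)) x = \1_E' (base x) :> R by [].
    have p0 : 0 <= \1_E' (base x) :> R by rewrite indicE.
    by rewrite ger0_norm// ler_piMl.
  rewrite /Rintegral integral_indic// setIT.
  suff q0 : quadruple (base @^-1` (E' : set (R[i])^o)) = 0%E.
    by rewrite (_ : fine _ = 0) ?mulr0//; exact: (congr1 fine q0).
  apply/eqP; rewrite eq_le measure_ge0 andbT -D0; apply: le_measure; rewrite ?inE//.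
    exact: (restr_preimage measurable_base mD).
  move=> x [_ /= xs]; apply: suppD => /supp_s; exact: xs.
have ir (S : set (borelC R)) : measurable S ->
    cintegrable quadruple (restr base unit_density S).
  move=> mS; have [mr r1] :=
    unit_bounded_restr measurable_base unit_bounded_density mS.
  apply: (cintegrable_le mr (g := fun=> 1)) => //.
  exact: finite_measure_integrable_cst.
have restrE : restr base unit_density E = fun x =>
    restr base unit_density E' x +
    \sum_(z <- s) (\1_E z)%:C * restr base unit_density [set z] x.
  apply/funext => x; rewrite /restr; set y := base x.
  have [ys|ys] := boolP (y \in s).
    rewrite (bigD1_seq y)//= big1_seq => [|z /andP[zy _]]; last first.
      rewrite [X in _ * (_ * X%:C)]indicE memNset ?mulr0// => yz.
      by move/eqP: zy; apply; rewrite yz.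
    have -> : (\1_E' y)%:C = 0 :> R[i] by rewrite indicE memNset// => -[_]; exact.
    have -> : (\1_[set y] y)%:C = 1 :> R[i] by rewrite indicE mem_set.
    by rewrite addr0 mulr0 add0r mulr1 mulrC.
  rewrite big1_seq => [|z /andP[_ zs]]; last first.
    rewrite [X in _ * (_ * X%:C)]indicE memNset ?mulr0// => yz.
    by move/negP: ys; apply; rewrite yz.
  rewrite addr0; congr (_ * _%:C); rewrite !indicE; congr (nat_of_bool _)%:R.
  by apply/idP/idP; rewrite !inE; [move=> Ey; split => //; exact/negP|case].
rewrite -cint_restr// restrE cintD; first last.
- apply: cintegrable_sum => z; apply: cintegrableZ; apply: ir.
  exact: measurable_point.
- exact: ir.
rewrite cint_restr// E'0 add0r cint_sum; last first.
  by move=> z; apply: cintegrableZ; apply: ir; exact: measurable_point.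
apply: eq_bigr => z _; rewrite cintZ; last by apply: ir; exact: measurable_point.
rewrite cint_restr; last exact: measurable_point.
by rewrite mulrC diracE indicE.
Qed.

(** A list of distinct support points of maximal length contains them all. *)
Lemma finitely_many_support_points n :
  (forall zeta : 'I_n.+1 -> R[i], injective zeta ->
    ~ forall i e, 0 < e ->
      (0 < quadruple (base @^-1` disc (zeta i) e))%E) ->
  exists s : seq R[i],
    [/\ (size s <= n)%N, uniq s & forall z, support_point z -> z \in s].
Proof.
move=> few.
pose P m := `[< exists s : seq R[i],
  [/\ size s = m, uniq s & forall z, z \in s -> support_point z] >].
have P0 : exists m, P m by exists 0%N; apply/asboolP; exists [::].
have Pn m : P m -> (m <= n)%N.
  move=> /asboolP[s [sm us supp]]; rewrite leqNgt; apply/negP => nm.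
  pose zeta (i : 'I_n.+1) := nth 0 s i.
  have lt_i (i : 'I_n.+1) : (i < size s)%N by rewrite sm (leq_trans (ltn_ord i)).
  apply: (few zeta).
    by move=> i j /eqP; rewrite nth_uniq// => /eqP/val_inj.
  by move=> i; apply: supp; exact: mem_nth.
have [m /asboolP[s [sm us supp]] maxm] := ex_maxnP P0 Pn.
exists s; split => //.
  by rewrite sm; apply: Pn; apply/asboolP; exists s.
move=> z sz; apply: contraT => zs.
have /maxm : P m.+1.
  apply/asboolP; exists (z :: s); split => /=; rewrite ?sm ?zs//.
  by move=> w; rewrite in_cons => /orP[/eqP ->//|]; exact: supp.
by rewrite ltnn.
Qed.

End complex_measure.

Theorem theorem6p1 (R : realType) (r : nat) (nu : complex_measure R)
    (gamma : R) (n : nat) :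
  (0 < r)%N ->
  0 < gamma ->
  (\int[cm_variation nu]_z
     (expR (gamma * ComplexField.Normc.normc z ^+ r))%:E < +oo)%E ->
  toeplitz_rank nu n ->
  (n < r)%N ->
  exists (m : nat) (zeta : 'I_m -> borelC R) (c : 'I_m -> R[i]),
    (m < r)%N /\
    forall E : set (borelC R), measurable E ->
      nu E = \sum_(j < m) c j * (fine (\d_(zeta j) E))%:C.
Proof.
move=> r0 gamma0 exp_lty rank_n nr.
have few := few_support_points (@cmeasurable_base R) (@measurable_base R) r0 gamma0
  (exponential_moment_quadruple exp_lty) (@unit_bounded_density R)
  (toeplitz_rank_lt r0 gamma0 exp_lty rank_n) nr (fun U oU _ => quarter_mass nu oU).
have [s [sn us supp]] := finitely_many_support_points few.
exists (size s), (fun j => s`_j), (fun j => nu [set s`_j]); split.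
  exact: leq_ltn_trans sn nr.
move=> E mE; rewrite (sum_of_atoms us supp mE) (big_nth 0) big_mkord.
by [].
Qed.
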